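(* Let $L>0$. For a curve $X\in \mathrm{Horiz}(\mathcal{D}_s)(L)$ with $\Lambda(s)=X(s)^{-1}\frac{dX}{ds}(s)$, and tangent vectors $v_j(s)=X(s)V_j(s)$ ($j=1,2$) at $X$, put $U_j(s)=\frac{dV_j}{ds}(s)-[\Lambda(s),V_j(s)]$ and define $$\omega_\Lambda(V_1,V_2)=-\int_0^L\langle \Lambda(s),[U_1(s),U_2(s)]\rangle\,ds .$$ Then both $\mathrm{Horiz}(\mathcal{D}_s)(L)$ and $\mathrm{Horiz}(\mathcal{PD}_s)(L)$ are symplectic Fréchet manifolds relative to $\omega$; that is, on each of these two spaces $\omega$ is a closed and non-degenerate differential 2-form.
   Context: Notation. $K=SU_2$, and $\mathfrak{k}=\mathfrak{su}_2$ is the space of trace-zero skew-Hermitian $2\times2$ complex matrices. Throughout, the bracket convention is $[A,B]=BA-AB$. On $\mathfrak k$, $\langle A,B\rangle=-2\,\mathrm{Tr}(AB)$, a positive definite form for which $$A_1=\tfrac12\begin{pmatrix} i&0\\0&-i\end{pmatrix},\quad A_2=\tfrac12\begin{pmatrix}0&1\\-1&0\end{pmatrix},\quad A_3=\tfrac12\begin{pmatrix}0&i\\ i&0\end{pmatrix}$$ is an orthonormal basis. All curves are smooth. Darboux curves on the sphere. An anchored Darboux curve is a pair of curves $(X(s),R(s))$, $s\in[0,L]$, in $K\times K$ with $X(0)=R(0)=I$ and $\frac{dX}{ds}=X\Lambda$, where $\Lambda(s)=R(s)A_1R^*(s)$. Its projection $X$ is called an (anchored) horizontal Darboux curve, and $\mathrm{Horiz}(\mathcal{D}_s)(L)$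 is the set of all of them. An anchored Darboux curve is frame-periodic if $R$ is a closed curve, $R(0)=R(L)$, where closed means smoothly closed, so that $R$ and $\Lambda$ are smoothly periodic with period $L$ (they extend to smooth $L$-periodic curves). $\mathrm{Horiz}(\mathcal{PD}_s)(L)$ is the set of horizontal projections $X$ of frame-periodic anchored Darboux curves. Both sets are regarded as Fréchet manifolds, as submanifolds of the Fréchet manifold of smooth maps $[0,L]\to K$. Tangent vectors. Tangent vectors at $X$ are the velocities at $t=0$ of smooth one-parameter families of curves in the space passing through $X$ at $t=0$. At $X\in\mathrm{Horiz}(\mathcal{D}_s)(L)$ they are the curves $v(s)=X(s)V(s)$ with $V(s)\in\mathfrak k$, $V(0)=0$ and $\frac{dV}{ds}=[\Lambda,V]+U$, where $U(s)\in\mathfrak k$ satisfies $U(0)=0$ and $\langle\Lambda(s),U(s)\rangle=0$. At $X\in \mathrm{Horiz}(\mathcal{PD}_s)(L)$ one requires in addition that $U$ be smoothly periodic with period $L$. Symplectic form. A differential 2-form $\omega$ on a Fréchet manifold $\mathcal M$ is symplectic if it is closed ($d\omega=0$, with $d$ the usual exterior derivative) and non-degenerate in the weak sense: if $v$ is a tangent vector at a point with $\omega(v,w)=0$ for all tangent vectors $w$ at that point, then $v=0$. *)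

(* Defs.v *)
(* Curves on [0, L] are functions on the subtype [seg L], so that equality of
   curves is equality on [0, L].  "Smooth" means C^oo up to the end points,
   expressed as: restriction of a C^oo map defined on the whole line (or, for
   one-parameter families of curves, on the whole plane). *)
From HB Require Import structures.
From mathcomp Require Import all_boot all_order all_algebra.
From mathcomp Require Import spectral complex.
From mathcomp Require Import all_classical all_reals all_analysis.
Import Order.TTheory GRing.Theory Num.Theory.
Import numFieldNormedType.Exports.

Set Implicit Arguments.
Unset Strict Implicit.
Unset Printing Implicit Defensive.

Local Open Scope classical_set_scope.
Local Open Scope ring_scope.
Local Open Scope sesquilinear_scope.

Definition SU2 (R : realType) (A : 'M[R[i]]_2) : Prop :=
  A \is unitarymx /\ \det A = 1.

Definition su2 (R : realType) (A : 'M[R[i]]_2) : Prop :=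
  A^t* = - A /\ \tr A = 0.

(* Opposite of the usual commutator convention. *)
Definition brk (R : realType) (A B : 'M[R[i]]_2) : 'M[R[i]]_2 :=
  B *m A - A *m B.

(* The trace is real on su2; the real part only fixes the codomain. *)
Definition inner (R : realType) (A B : 'M[R[i]]_2) : R :=
  - 2 * complex.Re (\tr (A *m B)).

Definition A1 (R : realType) : 'M[R[i]]_2 :=
  2^-1 *: (\matrix_(j < 2, k < 2) (if j == k then (-1) ^+ j * 'i%C else 0)).

Definition smooth1 (R : realType) (f : R -> R) : Prop :=
  forall n t, derivable (derive1n n f) t 1.

(* [g i j] is the partial derivative of order [i] in [t] and [j] in [s]. *)
Definition smooth2 (R : realType) (f : R -> R -> R) : Prop :=
  exists g : nat -> nat -> R -> R -> R,
    [/\ g 0%N 0%N = f,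
        forall i j (t s : R), is_derive t 1 (fun u : R => g i j u s) (g i.+1 j t s),
        forall i j (t s : R), is_derive s 1 (fun u : R => g i j t u) (g i j.+1 t s) &
        forall i j, continuous (fun p : R * R => g i j p.1 p.2)].

Definition mx_smooth1 (R : realType) (f : R -> 'M[R[i]]_2) : Prop :=
  forall a b, smooth1 (fun t => complex.Re (f t a b)) /\
              smooth1 (fun t => complex.Im (f t a b)).

Definition mx_smooth2 (R : realType) (f : R -> R -> 'M[R[i]]_2) : Prop :=
  forall a b, smooth2 (fun t s => complex.Re (f t s a b)) /\
              smooth2 (fun t s => complex.Im (f t s a b)).

Definition mx_derive1 (R : realType) (f : R -> 'M[R[i]]_2) (t : R) :
    'M[R[i]]_2 :=
  \matrix_(a < 2, b < 2)
    Complex (derive1 (fun u => complex.Re (f u a b)) t)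
            (derive1 (fun u => complex.Im (f u a b)) t).

Definition seg (R : realType) (L : R) : Type := {s : R | 0 <= s <= L}.

Definition curve (R : realType) (L : R) : Type := seg L -> 'M[R[i]]_2.

Definition extends (R : realType) (L : R) (g : R -> 'M[R[i]]_2)
    (x : curve L) : Prop :=
  forall s : seg L, g (val s) = x s.

Definition smooth (R : realType) (L : R) (x : curve L) : Prop :=
  exists g, mx_smooth1 g /\ extends g x.

(* Derivative of a smooth curve: that of any smooth extension, restricted to
   [0, L].  For 0 < L it does not depend on the extension. *)
Definition deriv (R : realType) (L : R) (x : curve L) : curve L :=
  fun s => mx_derive1
    (xget (fun _ : R => 0) [set g | mx_smooth1 g /\ extends g x]) (val s).

Definition smooth_periodic (R : realType) (L : R) (x : curve L) : Prop :=
  exists g, [/\ mx_smooth1 g, extends g x & forall s, g (s + L) = g s].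

Definition starts_at (R : realType) (L : R) (x : curve L)
    (A : 'M[R[i]]_2) : Prop :=
  forall s : seg L, val s = 0 -> x s = A.

Definition integral_seg (R : realType) (L : R) (f : seg L -> R) : R :=
  Rintegral (@lebesgue_measure R) `[0, L]
    (fun s : R => oapp f 0 (insub s)).

(** Submanifolds of the Frechet manifold of smooth curves [0, L] -> SU2.
    The smooth structure on a submanifold [M] is the induced one: a smooth path
    in [M] is a smooth one-parameter family of curves each of which lies in
    [M], and a map on an open subset of [M] is smooth when it sends smooth
    paths to smooth paths (on Frechet manifolds this is the same as being C^oo
    in the sense of Michal-Bastiani and Hamilton). *)

Definition smooth_family (R : realType) (L : R) (c : R -> curve L) : Prop :=
  exists h, mx_smooth2 h /\ forall t, extends (h t) (c t).

Definition smooth_path (R : realType) (L : R) (M : set (curve L))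
    (c : R -> curve L) : Prop :=
  smooth_family c /\ forall t, M (c t).

Definition velocity (R : realType) (L : R) (c : R -> curve L) (t : R) :
    curve L :=
  fun s => mx_derive1 (fun u => c u s) t.

(* Relative topology of uniform convergence of all derivatives. *)
Definition open_in (R : realType) (L : R) (M O : set (curve L)) : Prop :=
  O `<=` M /\
  forall x, O x -> exists (k : nat) (e : R), 0 < e /\
    forall y, M y ->
      (forall j s a b, (j <= k)%N ->
         complex.Re `|iter j (@deriv R L) y s a b
                      - iter j (@deriv R L) x s a b| < e) ->
      O y.

(* [T x] is the tangent space of the manifold at [x]. *)
Definition vector_field (R : realType) (L : R) (T : curve L -> set (curve L))
    (O : set (curve L)) (xi : curve L -> curve L) : Prop :=
  (forall x, O x -> T x (xi x)) /\
  (forall c, smooth_path O c -> smooth_family (fun t => xi (c t))).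

Definition path_of (R : realType) (L : R) (O : set (curve L)) (x v : curve L)
    (c : R -> curve L) : Prop :=
  [/\ smooth_path O c, c 0 = x & velocity c 0 = v].

(* Directional derivative of a function, resp. of a vector field, at [c 0] in
   the direction of the tangent vector [velocity c 0]. *)
Definition dirD (R : realType) (L : R) (c : R -> curve L)
    (f : curve L -> R) : R :=
  derive1 (fun t => f (c t)) 0.

Definition dirDv (R : realType) (L : R) (c : R -> curve L)
    (xi : curve L -> curve L) : curve L :=
  velocity (fun t => xi (c t)) 0.

(* [xi1, xi2] at [c1 0 = c2 0], where [c1], [c2] are paths representing the
   values of [xi1], [xi2] there. *)
Definition lie_bracket (R : realType) (L : R) (c1 c2 : R -> curve L)
    (xi1 xi2 : curve L -> curve L) : curve L :=
  fun s => dirDv c1 xi2 s - dirDv c2 xi1 s.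

(* Value at [x] of (d omega)(xi1, xi2, xi3), the paths [ci] through [x]
   representing the tangent vectors [xii x]: the invariant formula for the
   exterior derivative, which depends on the [xii] only through [xii x] and not
   on the [ci]. *)
Definition ext_deriv (R : realType) (L : R)
    (omega : curve L -> curve L -> curve L -> R) (x : curve L)
    (xi1 xi2 xi3 : curve L -> curve L) (c1 c2 c3 : R -> curve L) : R :=
  dirD c1 (fun y => omega y (xi2 y) (xi3 y))
  - dirD c2 (fun y => omega y (xi1 y) (xi3 y))
  + dirD c3 (fun y => omega y (xi1 y) (xi2 y))
  - omega x (lie_bracket c1 c2 xi1 xi2) (xi3 x)
  + omega x (lie_bracket c1 c3 xi1 xi3) (xi2 x)
  - omega x (lie_bracket c2 c3 xi2 xi3) (xi1 x).

Definition two_form (R : realType) (L : R) (M : set (curve L))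
    (T : curve L -> set (curve L))
    (omega : curve L -> curve L -> curve L -> R) : Prop :=
  [/\ forall x v w, M x -> T x v -> T x w -> omega x w v = - omega x v w,
      forall x (a : R) u v w, M x -> T x u -> T x v -> T x w ->
        omega x (fun s => a%:C%C *: u s + v s) w
        = a * omega x u w + omega x v w &
      forall c v w, smooth_path M c ->
        smooth_family v -> (forall t, T (c t) (v t)) ->
        smooth_family w -> (forall t, T (c t) (w t)) ->
        smooth1 (fun t => omega (c t) (v t) (w t))].

Definition closed_form (R : realType) (L : R) (M : set (curve L))
    (T : curve L -> set (curve L))
    (omega : curve L -> curve L -> curve L -> R) : Prop :=
  forall (O : set (curve L)) xi1 xi2 xi3, open_in M O ->
    vector_field T O xi1 -> vector_field T O xi2 -> vector_field T O xi3 ->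
  forall x c1 c2 c3, O x ->
    path_of O x (xi1 x) c1 -> path_of O x (xi2 x) c2 ->
    path_of O x (xi3 x) c3 ->
  ext_deriv omega x xi1 xi2 xi3 c1 c2 c3 = 0.

Definition nondegenerate_form (R : realType) (L : R) (M : set (curve L))
    (T : curve L -> set (curve L))
    (omega : curve L -> curve L -> curve L -> R) : Prop :=
  forall x v, M x -> T x v -> (forall w, T x w -> omega x v w = 0) ->
  v = (fun _ => 0).

Definition symplectic (R : realType) (L : R) (M : set (curve L))
    (T : curve L -> set (curve L))
    (omega : curve L -> curve L -> curve L -> R) : Prop :=
  [/\ two_form M T omega, closed_form M T omega & nondegenerate_form M T omega].

(** Anchored Darboux curves on the sphere; [F] is the frame. *)

Definition anchored_darboux (R : realType) (L : R) (X F : curve L) : Prop :=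
  [/\ smooth X /\ smooth F,
      forall s, SU2 (X s) /\ SU2 (F s),
      starts_at X 1%:M /\ starts_at F 1%:M &
      forall s, deriv X s = X s *m (F s *m A1 R *m (F s)^t*)].

Definition HorizD (R : realType) (L : R) : set (curve L) :=
  [set X | exists F, anchored_darboux X F].

Definition HorizPD (R : realType) (L : R) : set (curve L) :=
  [set X | exists F, anchored_darboux X F /\ smooth_periodic F].

Definition Lam (R : realType) (L : R) (X : curve L) : curve L :=
  fun s => invmx (X s) *m deriv X s.

Definition tangent_data (R : realType) (L : R) (X v V U : curve L) : Prop :=
  [/\ smooth V /\ smooth U,
      forall s, su2 (V s) /\ su2 (U s),
      starts_at V 0 /\ starts_at U 0,
      forall s, deriv V s = brk (Lam X s) (V s) + U s
                /\ inner (Lam X s) (U s) = 0 &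
      forall s, v s = X s *m V s].

Definition tangentD (R : realType) (L : R) (X : curve L) : set (curve L) :=
  [set v | exists V U, tangent_data X v V U].

Definition tangentPD (R : realType) (L : R) (X : curve L) : set (curve L) :=
  [set v | exists V U, tangent_data X v V U /\ smooth_periodic U].

Definition left_triv (R : realType) (L : R) (X v : curve L) : curve L :=
  fun s => invmx (X s) *m v s.

(* The velocity of [Lam] along a path with velocity [v] at [X]. *)
Definition Upart (R : realType) (L : R) (X v : curve L) : curve L :=
  fun s => deriv (left_triv X v) s - brk (Lam X s) (left_triv X v s).

Definition omega (R : realType) (L : R) (X v1 v2 : curve L) : R :=
  - integral_seg
      (fun s => inner (Lam X s) (brk (Upart X v1 s) (Upart X v2 s))).

(* Main.v *)
Require Import Defs.
From mathcomp Require Import all_boot all_order all_algebra.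
From mathcomp Require Import spectral complex.
From mathcomp Require Import all_classical all_reals all_analysis.
From mathcomp Require Import ring lra.
Import Order.TTheory GRing.Theory Num.Theory.
Import numFieldNormedType.Exports.

(** Let [v = X V] be a tangent vector at a horizontal curve [X].  It is the
    velocity of a path of curves, and [U = V' - [Lam, V]], where
    [[A, B] = BA - AB], is the velocity along that path of [Lam = X^-1 X'], a
    curve on the unit sphere of [su2].  The density [<Lam, [U1, U2]>] is up to
    sign the area form of the sphere evaluated at two tangent vectors, so
    [omega] is an integral over [s] of pullbacks of the area form by the maps
    sending [X] to [Lam s].  It is closed because there are no non-zero 3-forms
    on a surface, and it is non-degenerate because the area form is, and because
    every field [U] tangent to the sphere along [Lam] with [U 0 = 0] comes from
    a tangent vector.

    Closedness is checked on the invariant formula for the exterior derivative.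
    For a curve of matrices [w] put [U_X(w) = X^* (w' - w Lam)]; this is [Upart]
    on tangent vectors.  Differentiating [U_X(xi_j)] along a path with velocity
    [xi_i = X V_i] gives [- (V_i U_j + V_j U_i) + U_X(D_i xi_j)]
    ([jU_variation]).  The first term is symmetric in [i] and [j], so that
    [D_i U_j - D_j U_i = U_X([xi_i, xi_j])], and the terms of the exterior
    derivative that contain derivatives of the [U_j] cancel in pairs
    ([exterior_derivative_cancels]).  The others are triple products
    [<U_i, [U_j, U_k]>] of vectors orthogonal to the unit vector [Lam]; they are
    coplanar, so these products vanish ([inner_coplanar]).

    For non-degeneracy, [v] is tested against the tangent vector whose [U] is
    [[Lam, U]].  It exists because [w X^-1] only has to be a primitive of
    [X [Lam, U] X^-1] ([tangent_lift]).  The density is then [|U|^2]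
    ([inner_brk_brk]), so [U = 0]; hence [v X^-1], whose derivative is
    [X U X^-1], is constant, and it starts at 0.  If the frame and [U] are
    periodic then so is [[Lam, U]], and the same test settles the periodic case.

    All differentiations in [t] and [s] are carried out on jets, that is, on
    matrix-valued functions given with all their mixed partial derivatives.
    Jets are stable under products, and the entries of a product jet compute, so
    a derivative of a polynomial expression in jets is read off by conversion.
    A single curve is treated as a family that is constant in [t]. *)

Set Implicit Arguments.
Unset Strict Implicit.
Unset Printing Implicit Defensive.
Local Open Scope classical_set_scope.
Local Open Scope ring_scope.
Local Open Scope sesquilinear_scope.

(* Without this, [deriv] is the formal derivative of polynomials. *)
Local Notation deriv := Defs.deriv.

(** * Derivatives of complex-valued and matrix-valued functions *)

Section Calculus.
Variable R : realType.
Local Notation C := R[i].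
Local Notation M := 'M[R[i]]_2.
Implicit Types (A B : M) (t s : R).

Lemma ReD (x y : C) : complex.Re (x + y) = complex.Re x + complex.Re y.
Proof. by case: x y => [a b] [c d]. Qed.
Lemma ImD (x y : C) : complex.Im (x + y) = complex.Im x + complex.Im y.
Proof. by case: x y => [a b] [c d]. Qed.
Lemma ReN (x : C) : complex.Re (- x) = - complex.Re x.
Proof. by case: x. Qed.
Lemma ImN (x : C) : complex.Im (- x) = - complex.Im x.
Proof. by case: x. Qed.
Lemma ReM (x y : C) : complex.Re (x * y) =
  complex.Re x * complex.Re y - complex.Im x * complex.Im y.
Proof. by case: x y => [a b] [c d]. Qed.
Lemma ImM (x y : C) : complex.Im (x * y) =
  complex.Re x * complex.Im y + complex.Im x * complex.Re y.
Proof. by case: x y => [a b] [c d]. Qed.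

Lemma complexP (x y : C) :
  complex.Re x = complex.Re y -> complex.Im x = complex.Im y -> x = y.
Proof. by case: x y => [a b] [c d] /= -> ->. Qed.

Lemma mulmx2E A B a b : (A *m B) a b = A a 0 * B 0 b + A a 1 * B 1 b.
Proof.
rewrite mxE big_ord_recl big_ord_recl big_ord0 addr0.
by congr (_ + A a _ * B _ b); apply/val_inj.
Qed.

Lemma adjE A a b : (A^t*) a b = conjc (A b a).
Proof. by rewrite !mxE. Qed.

Definition cx_derives (f : R -> C) t (d : C) : Prop :=
  is_derive t 1 (fun u => complex.Re (f u)) (complex.Re d) /\
  is_derive t 1 (fun u => complex.Im (f u)) (complex.Im d).

Lemma cx_derivesD f g t d e : cx_derives f t d -> cx_derives g t e ->
  cx_derives (fun u => f u + g u) t (d + e).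
Proof.
move=> [f1 f2] [g1 g2]; split.
- rewrite ReD (_ : (fun u => _) = (fun u => complex.Re (f u)) +
    (fun u => complex.Re (g u))); first exact: is_deriveD.
  by apply/funext => u; rewrite ReD.
- rewrite ImD (_ : (fun u => _) = (fun u => complex.Im (f u)) +
    (fun u => complex.Im (g u))); first exact: is_deriveD.
  by apply/funext => u; rewrite ImD.
Qed.

Lemma cx_derivesN f t d : cx_derives f t d -> cx_derives (fun u => - f u) t (- d).
Proof.
move=> [f1 f2]; split.
- rewrite ReN (_ : (fun u => _) = - (fun u => complex.Re (f u))).
    exact: is_deriveN.
  by apply/funext => u; rewrite ReN.
- rewrite ImN (_ : (fun u => _) = - (fun u => complex.Im (f u))).
    exact: is_deriveN.
  by apply/funext => u; rewrite ImN.
Qed.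

Lemma cx_derivesJ f t d : cx_derives f t d ->
  cx_derives (fun u => conjc (f u)) t (conjc d).
Proof.
move=> [f1 f2]; split.
- rewrite (_ : complex.Re _ = complex.Re d); last by case: (d).
  rewrite (_ : (fun u => _) = (fun u => complex.Re (f u))) //.
  by apply/funext => u; case: (f u).
- rewrite (_ : complex.Im _ = - complex.Im d); last by case: (d).
  rewrite (_ : (fun u => _) = - (fun u => complex.Im (f u))).
    exact: is_deriveN.
  by apply/funext => u; rewrite /= -[LHS]/(complex.Im _) fctE; case: (f u).
Qed.

Lemma cx_derivesM f g t d e : cx_derives f t d -> cx_derives g t e ->
  cx_derives (fun u => f u * g u) t (d * g t + f t * e).
Proof.
move=> [f1 f2] [g1 g2]; split.
- rewrite (_ : (fun u => _) =
    (fun u => complex.Re (f u)) * (fun u => complex.Re (g u)) -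
    (fun u => complex.Im (f u)) * (fun u => complex.Im (g u))).
    apply: is_derive_eq (is_deriveB (is_deriveM f1 g1) (is_deriveM f2 g2)) _.
    by rewrite ReD !ReM /GRing.scale /=; ring.
  by apply/funext => u; rewrite ReM.
- rewrite (_ : (fun u => _) =
    (fun u => complex.Re (f u)) * (fun u => complex.Im (g u)) +
    (fun u => complex.Im (f u)) * (fun u => complex.Re (g u))).
    apply: is_derive_eq (is_deriveD (is_deriveM f1 g2) (is_deriveM f2 g1)) _.
    by rewrite ImD !ImM /GRing.scale /=; ring.
  by apply/funext => u; rewrite ImM.
Qed.

Lemma cx_derives_cst (x : C) t : cx_derives (fun _ => x) t 0.
Proof. by split; apply: is_derive_cst. Qed.

Lemma cx_derives_uniq f t d e : cx_derives f t d -> cx_derives f t e -> d = e.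
Proof.
move=> [[_ f1] [_ f2]] [[_ g1] [_ g2]].
by apply: complexP; rewrite -?f1 -?g1 -?f2 -?g2.
Qed.

Definition mx_derives (f : R -> M) t (D : M) : Prop :=
  forall a b, cx_derives (fun u => f u a b) t (D a b).

Lemma mx_derivesD f g t D E : mx_derives f t D -> mx_derives g t E ->
  mx_derives (fun u => f u + g u) t (D + E).
Proof.
move=> fD gE a b; rewrite mxE.
rewrite (_ : (fun u => _) = (fun u => f u a b + g u a b)).
  exact: cx_derivesD.
by apply/funext => u; rewrite mxE.
Qed.

Lemma mx_derivesN f t D : mx_derives f t D ->
  mx_derives (fun u => - f u) t (- D).
Proof.
move=> fD a b; rewrite mxE.
rewrite (_ : (fun u => _) = (fun u => - f u a b)).
  exact: cx_derivesN.
by apply/funext => u; rewrite mxE.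
Qed.

Lemma mx_derives_adj f t D : mx_derives f t D ->
  mx_derives (fun u => (f u)^t*) t (D^t*).
Proof.
move=> fD a b; rewrite adjE.
rewrite (_ : (fun u => _) = (fun u => conjc (f u b a))).
  exact: cx_derivesJ.
by apply/funext => u; rewrite adjE.
Qed.

Lemma mx_derivesM f g t D E : mx_derives f t D -> mx_derives g t E ->
  mx_derives (fun u => f u *m g u) t (D *m g t + f t *m E).
Proof.
move=> fD gE a b; rewrite mxE !mulmx2E addrACA.
rewrite (_ : (fun u => _) = (fun u => f u a 0 * g u 0 b + f u a 1 * g u 1 b)).
  by apply: cx_derivesD; apply: cx_derivesM.
by apply/funext => u; rewrite mulmx2E.
Qed.

Lemma mx_derives_cst A t : mx_derives (fun _ => A) t 0.
Proof. by move=> a b; rewrite mxE; exact: cx_derives_cst. Qed.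

Lemma mx_derives_uniq f t D E : mx_derives f t D -> mx_derives f t E -> D = E.
Proof.
by move=> fD fE; apply/matrixP => a b; apply: cx_derives_uniq (fD a b) (fE a b).
Qed.

Lemma mx_derivesE f t D : mx_derives f t D -> mx_derive1 f t = D.
Proof.
move=> fD; apply/matrixP => a b; rewrite mxE !derive1E.
by have [f1 f2] := fD a b; rewrite !derive_val; case: (D a b).
Qed.

Section Continuity.
Variable T : topologicalType.

Definition cx_continuous (f : T -> C) : Prop :=
  continuous (fun p => complex.Re (f p)) /\
  continuous (fun p => complex.Im (f p)).

Lemma cx_continuousD f g : cx_continuous f -> cx_continuous g ->
  cx_continuous (fun p => f p + g p).
Proof.
move=> [f1 f2] [g1 g2]; split => p.
- under eq_fun do rewrite ReD.
  by apply: cvgD; [exact: f1|exact: g1].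
- under eq_fun do rewrite ImD.
  by apply: cvgD; [exact: f2|exact: g2].
Qed.

Lemma cx_continuousN f : cx_continuous f -> cx_continuous (fun p => - f p).
Proof.
move=> [f1 f2]; split => p.
- by under eq_fun do rewrite ReN; apply: cvgN; exact: f1.
- by under eq_fun do rewrite ImN; apply: cvgN; exact: f2.
Qed.

Lemma cx_continuousJ f : cx_continuous f -> cx_continuous (fun p => conjc (f p)).
Proof.
move=> [f1 f2]; split => p.
- rewrite (_ : (fun u => _) = (fun u => complex.Re (f u))); first exact: f1.
  by apply/funext => u; case: (f u).
- rewrite (_ : (fun u => _) = (fun u => - complex.Im (f u))).
    by apply: cvgN; exact: f2.
  by apply/funext => u; case: (f u).
Qed.

Lemma cx_continuousM f g : cx_continuous f -> cx_continuous g ->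
  cx_continuous (fun p => f p * g p).
Proof.
move=> [f1 f2] [g1 g2]; split => p.
- under eq_fun do rewrite ReM.
  apply: cvgB; first by apply: cvgM; [exact: f1|exact: g1].
  by apply: cvgM; [exact: f2|exact: g2].
- under eq_fun do rewrite ImM.
  apply: cvgD; first by apply: cvgM; [exact: f1|exact: g2].
  by apply: cvgM; [exact: f2|exact: g1].
Qed.

Definition mx_continuous (f : T -> M) : Prop :=
  forall a b, cx_continuous (fun p => f p a b).

Lemma mx_continuousD f g : mx_continuous f -> mx_continuous g ->
  mx_continuous (fun p => f p + g p).
Proof.
move=> fC gC a b; rewrite (_ : (fun p => _) = (fun p => f p a b + g p a b)).
  exact: cx_continuousD.
by apply/funext => p; rewrite mxE.
Qed.

Lemma mx_continuousN f : mx_continuous f -> mx_continuous (fun p => - f p).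
Proof.
move=> fC a b; rewrite (_ : (fun p => _) = (fun p => - f p a b)).
  exact: cx_continuousN.
by apply/funext => p; rewrite mxE.
Qed.

Lemma mx_continuous_adj f : mx_continuous f ->
  mx_continuous (fun p => (f p)^t*).
Proof.
move=> fC a b; rewrite (_ : (fun p => _) = (fun p => conjc (f p b a))).
  exact: cx_continuousJ.
by apply/funext => p; rewrite adjE.
Qed.

Lemma mx_continuousM f g : mx_continuous f -> mx_continuous g ->
  mx_continuous (fun p => f p *m g p).
Proof.
move=> fC gC a b.
rewrite (_ : (fun p => _) = (fun p => f p a 0 * g p 0 b + f p a 1 * g p 1 b)).
  by apply: cx_continuousD; apply: cx_continuousM.
by apply/funext => p; rewrite mulmx2E.
Qed.

Lemma mx_continuous_cst A : mx_continuous (fun _ => A).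
Proof. by move=> a b; split => p; exact: cvg_cst. Qed.

End Continuity.

End Calculus.

(** * Jets *)

Section Jets.
Variable R : realType.
Local Notation M := 'M[R[i]]_2.
Implicit Types (A B : M) (t s : R).

Definition jet := nat -> nat -> R -> R -> M.

(** The index [i j] counts derivatives in [t] and in [s]. That a single family
    of functions has both kinds of derivatives encodes that mixed partials
    commute. *)
Definition is_jet (G : jet) : Prop :=
  [/\ forall i j t s, mx_derives (fun u => G i j u s) t (G i.+1 j t s),
      forall i j t s, mx_derives (fun u => G i j t u) s (G i j.+1 t s) &
      forall i j, mx_continuous (fun p : R * R => G i j p.1 p.2)].

(** The real and imaginary parts of the four entries are smooth independently
    of one another; their witnesses have to be chosen together. *)
Lemma is_jetP (h : R -> R -> M) :
  mx_smooth2 h <-> exists2 G, is_jet G & G 0%N 0%N = h.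
Proof.
split=> [hS|[G [Gt Gs Gc] <-] a b]; last first.
  split.
  - exists (fun i j t s => complex.Re (G i j t s a b)).
    by split=> // i j; [move=> t s; have [] := Gt i j t s a b
                      | move=> t s; have [] := Gs i j t s a b
                      | have [] := Gc i j a b].
  - exists (fun i j t s => complex.Im (G i j t s a b)).
    by split=> // i j; [move=> t s; have [] := Gt i j t s a b
                      | move=> t s; have [] := Gs i j t s a b
                      | have [] := Gc i j a b].
have /choice[g gP] : forall ab : 'I_2 * 'I_2,
    exists g : (nat -> nat -> R -> R -> R) * (nat -> nat -> R -> R -> R),
    [/\ g.1 0%N 0%N = (fun t s => complex.Re (h t s ab.1 ab.2)),
        g.2 0%N 0%N = (fun t s => complex.Im (h t s ab.1 ab.2)),
        forall i j (t s : R),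
          is_derive t 1 (fun u : R => g.1 i j u s) (g.1 i.+1 j t s) /\
          is_derive t 1 (fun u : R => g.2 i j u s) (g.2 i.+1 j t s),
        forall i j (t s : R),
          is_derive s 1 (fun u : R => g.1 i j t u) (g.1 i j.+1 t s) /\
          is_derive s 1 (fun u : R => g.2 i j t u) (g.2 i j.+1 t s) &
        forall i j, continuous (fun p : R * R => g.1 i j p.1 p.2) /\
          continuous (fun p : R * R => g.2 i j p.1 p.2)].
  move=> [a b]; have [[g1 [p1 q1 r1 s1]] [g2 [p2 q2 r2 s2]]] := hS a b.
  by exists (g1, g2); split.
exists (fun i j t s => \matrix_(a, b)
  Complex ((g (a, b)).1 i j t s) ((g (a, b)).2 i j t s)).
  split=> [i j t s a b|i j t s a b|i j a b];
    have [_ _ gt gs gc] := gP (a, b); split; under eq_fun do rewrite mxE /=;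
    rewrite ?mxE /=.
  - by have [] := gt i j t s.
  - by have [] := gt i j t s.
  - by have [] := gs i j t s.
  - by have [] := gs i j t s.
  - by have [] := gc i j.
  - by have [] := gc i j.
apply/funext => t; apply/funext => s; apply/matrixP => a b; rewrite mxE.
have [-> -> _ _ _] := gP (a, b); by case: (h t s a b).
Qed.

Definition jcst A : jet := fun i j _ _ => if (i == 0)%N && (j == 0)%N then A else 0.
Definition jadd (a b : jet) : jet := fun i j t s => a i j t s + b i j t s.
Definition jopp (a : jet) : jet := fun i j t s => - a i j t s.
Definition jadj (a : jet) : jet := fun i j t s => (a i j t s)^t*.
Definition jdt (a : jet) : jet := fun i j => a i.+1 j.
Definition jds (a : jet) : jet := fun i j => a i j.+1.

(** The Leibniz rule without binomial coefficients: a derivative is moved onto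
    one factor or onto the other, by recursion on the orders. *)
Fixpoint jmul_s j (a b : jet) t s : M :=
  if j is j'.+1 then jmul_s j' (jds a) b t s + jmul_s j' a (jds b) t s
  else a 0%N 0%N t s *m b 0%N 0%N t s.

Fixpoint jmul_ts i j (a b : jet) t s : M :=
  if i is i'.+1 then jmul_ts i' j (jdt a) b t s + jmul_ts i' j a (jdt b) t s
  else jmul_s j a b t s.

Definition jmul (a b : jet) : jet := fun i j t s => jmul_ts i j a b t s.

Lemma is_jet_cst A : is_jet (jcst A).
Proof.
split=> [i j t s|i j t s|i j]; rewrite /jcst ?andbF ?andFb;
  by [exact: mx_derives_cst|exact: mx_continuous_cst].
Qed.

Lemma is_jetD a b : is_jet a -> is_jet b -> is_jet (jadd a b).
Proof.
by move=> [a1 a2 a3] [b1 b2 b3]; split=> *;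
  [exact: mx_derivesD|exact: mx_derivesD|exact: mx_continuousD].
Qed.

Lemma is_jetN a : is_jet a -> is_jet (jopp a).
Proof.
by move=> [a1 a2 a3]; split=> *;
  [exact: mx_derivesN|exact: mx_derivesN|exact: mx_continuousN].
Qed.

Lemma is_jet_adj a : is_jet a -> is_jet (jadj a).
Proof.
by move=> [a1 a2 a3]; split=> *;
  [exact: mx_derives_adj|exact: mx_derives_adj|exact: mx_continuous_adj].
Qed.

Lemma is_jet_dt a : is_jet a -> is_jet (jdt a).
Proof. by move=> [a1 a2 a3]; split=> *; [exact: a1|exact: a2|exact: a3]. Qed.

Lemma is_jet_ds a : is_jet a -> is_jet (jds a).
Proof. by move=> [a1 a2 a3]; split=> *; [exact: a1|exact: a2|exact: a3]. Qed.

(** The [t]-derivative passes through the recursion on [i] by definition.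
    Across the recursion on [j] it does so up to regrouping the four terms
    that one derivative in each variable produces. *)
Lemma is_jetM a b : is_jet a -> is_jet b -> is_jet (jmul a b).
Proof.
move=> aJ bJ; split=> i j.
- move=> t s; elim: i a b aJ bJ => [|i IH] a b aJ bJ; last first.
    by apply: mx_derivesD; apply: IH => //; exact: is_jet_dt.
  elim: j a b aJ bJ => [|j IH] a b aJ bJ.
    by apply: (mx_derivesM (f := fun u => a 0%N 0%N u s)
                (g := fun u => b 0%N 0%N u s)); [case: aJ|case: bJ].
  rewrite (_ : jmul a b 1 j.+1 t s =
    jmul (jds a) b 1 j t s + jmul a (jds b) 1 j t s).
    by apply: mx_derivesD; apply: IH => //; exact: is_jet_ds.
  by rewrite /jmul /= addrACA.
- move=> t s; elim: i a b aJ bJ => [|i IH] a b aJ bJ; last first.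
    by apply: mx_derivesD; apply: IH => //; exact: is_jet_dt.
  elim: j a b aJ bJ => [|j IH] a b aJ bJ.
    by apply: (mx_derivesM (f := fun u => a 0%N 0%N t u)
                (g := fun u => b 0%N 0%N t u)); [case: aJ|case: bJ].
  by apply: mx_derivesD; apply: IH => //; exact: is_jet_ds.
- elim: i a b aJ bJ => [|i IH] a b aJ bJ; last first.
    by apply: mx_continuousD; apply: IH => //; exact: is_jet_dt.
  elim: j a b aJ bJ => [|j IH] a b aJ bJ.
    by apply: mx_continuousM; [case: aJ|case: bJ].
  by apply: mx_continuousD; apply: IH => //; exact: is_jet_ds.
Qed.

End Jets.

(** * Real functions on a segment *)

Section RealFunctions.
Variable R : realType.
Local Notation mu := (@lebesgue_measure R).
Implicit Types (L t s : R).

Lemma derive1nP (g : nat -> R -> R) :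
  (forall n t, is_derive t 1 (g n) (g n.+1 t)) -> forall n, derive1n n (g 0%N) = g n.
Proof.
move=> gD; elim=> [//|n IH].
by rewrite derive1nS IH; apply/funext => t; rewrite derive1E derive_val.
Qed.

Lemma smooth1_of_derives (g : nat -> R -> R) :
  (forall n t, is_derive t 1 (g n) (g n.+1 t)) -> smooth1 (g 0%N).
Proof. by move=> gD n t; rewrite (derive1nP gD); exact: ex_derive. Qed.

Lemma smooth1_derives (f : R -> R) : smooth1 f ->
  forall n t, is_derive t 1 (derive1n n f) (derive1n n.+1 f t).
Proof.
by move=> fS n t; apply: DeriveDef; [exact: fS|rewrite derive1nS derive1E].
Qed.

Lemma is_derive_continuous (f f' : R -> R) :
  (forall t, is_derive t 1 f (f' t)) -> continuous f.
Proof.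
move=> fD t; apply/differentiable_continuous/derivable1_diffP.
exact: (@ex_derive _ _ _ _ _ _ _ (fD t)).
Qed.

Lemma continuous_slice (f : R -> R -> R) t :
  continuous (fun p : R * R => f p.1 p.2) -> continuous (f t).
Proof.
move=> fC s; apply: (@continuous_comp _ _ _ (fun s => (t, s))
  (fun p : R * R => f p.1 p.2)); last exact: fC.
exact: (cvg_pair (cvg_cst t) cvg_id).
Qed.

Lemma continuous_integrable a b (f : R -> R) : continuous f ->
  mu.-integrable `[a, b] (EFin \o f).
Proof.
move=> fC; apply: continuous_compact_integrable; first exact: segment_compact.
exact: continuous_subspaceT.
Qed.

(** On [[t - 1, t + 1]] x [[0, L]] the partial derivative is bounded by
    compactness, and this constant dominates it. *)
Lemma is_derive_integral L (f f' : R -> R -> R) t :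
  continuous (fun p : R * R => f p.1 p.2) ->
  continuous (fun p : R * R => f' p.1 p.2) ->
  (forall t s, is_derive t 1 (f ^~ s) (f' t s)) ->
  is_derive t 1 (fun u => \int[mu]_(s in `[0, L]) f u s)
    (\int[mu]_(s in `[0, L]) f' t s).
Proof.
move=> fC fC' fD.
have /compact_bounded[K [_ KP]] : compact
    [set f' p.1 p.2 | p in `[t - 1, t + 1] `*` `[0, L]].
  apply: continuous_compact; first exact: continuous_subspaceT.
  by apply: compact_setX; exact: segment_compact.
have tI : `]t - 1, t + 1[%classic t.
  by rewrite /= in_itv /=; apply/andP; split; lra.
have intf x : `]t - 1, t + 1[%classic x -> mu.-integrable `[0, L] (EFin \o f x).
  by move=> _; apply: continuous_integrable; exact: continuous_slice.
have derf x y : `]t - 1, t + 1[%classic x -> `[0, L]%classic y ->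
    derivable (f ^~ y) x 1 by move=> _ _; exact: ex_derive.
have derf' x y : partial1of2 f x y = f' x y.
  by rewrite partial1of2E derive_val.
(* [+ 1] because [K] bounds only through the numbers above it. *)
pose G := fun _ : R => `|K| + 1.
have G0 y : 0 <= G y by rewrite /G addr_ge0.
have intG : mu.-integrable `[0, L] (EFin \o G).
  by apply: continuous_integrable => y; exact: cvg_cst.
have GP x y : `]t - 1, t + 1[%classic x -> `[0, L]%classic y ->
    `|partial1of2 f x y| <= G y.
  move=> xI yI; rewrite derf'; apply: (KP (G y)).
    by rewrite /G (le_lt_trans (ler_norm K))// ltrDl.
  exists (x, y) => //; split=> //=.
  by move: xI; rewrite /= !in_itv /= => /andP[/ltW -> /ltW ->].
apply: DeriveDef.
  exact: (derivable_under_integral _ tI intf derf G0 intG GP).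
rewrite -derive1E (differentiation_under_integral _ tI intf derf G0 intG GP) //.
by apply: eq_Rintegral => y _; rewrite derf'.
Qed.

(** The primitive is needed on the whole line, because smoothness on [[0, L]]
    asks for a smooth extension; hence the second integral, which serves for
    [s < 0]. *)
Lemma primitive_exists (f : R -> R) : continuous f ->
  exists2 F : R -> R, F 0 = 0 & forall s, is_derive s 1 F (f s).
Proof.
move=> fC.
pose F s := \int[mu]_(u in `]0, s]) f u - \int[mu]_(u in `]s, 0]) f u.
have fI a b : mu.-integrable `]a, b] (EFin \o f).
  apply: integrableS (continuous_integrable a b fC) => //.
  exact: subset_itv_oc_cc.
(* Locally [F] is, up to a constant, the integral from a point to the left. *)
have FE a s : a <= 0 -> a <= s ->
    F s = \int[mu]_(u in `]a, s]) f u - \int[mu]_(u in `]a, 0]) f u.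
  move=> a0 as'; rewrite /F; have [s0|/ltW s0] := leP 0 s.
    rewrite [in X in _ - X]set_itv_ge ?bnd_simp -?leNgt// Rintegral_set0 subr0.
    by rewrite Rintegral_itvB ?bnd_simp.
  rewrite [in X in X - _]set_itv_ge ?bnd_simp -?leNgt// Rintegral_set0 sub0r.
  by rewrite -(@Rintegral_itvB _ f (BRight a) (BRight 0) s) ?bnd_simp// opprB.
exists F => [|s].
  by rewrite /F set_itv_ge ?bnd_simp ?ltxx// Rintegral_set0 subr0.
pose a := Num.min 0 s - 1.
have a0 : a < 0 by rewrite /a ltrBlDr add0r gt_min ltr01.
have as' : a < s by rewrite /a ltrBlDr gt_min ltrDl ltr01 orbT.
have [GD GE] := @continuous_FTC1 R f (BRight a) s (s + 1) (ltac:(by rewrite ltrDl))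
  (fI a (s + 1)) as' (fC s).
pose c := \int[mu]_(u in `]a, 0]) f u.
apply: (@near_eq_is_derive _ _ _
    ((fun x => \int[mu]_(u in `]a, x]) f u) - cst c)).
  near=> x; rewrite fctE /= (FE a)// ltW//.
  by near: x; exact: lt_nbhsr.
rewrite -[f s]subr0; apply: is_deriveB.
by apply: DeriveDef; [exact: GD|rewrite -derive1E; exact: GE].
Unshelve. all: by end_near. Qed.

(** At an end point the difference quotient vanishes on one side only, which
    is enough because the two-sided limit is known to exist. *)
Lemma is_derive_zero_on_seg L (f : R -> R) f' s : 0 < L ->
  (forall u, 0 <= u <= L -> f u = 0) -> 0 <= s <= L ->
  is_derive s 1 f f' -> f' = 0.
Proof.
move=> L0 f0 /andP[s0 sL] [fd <-].
have fs : f s = 0 by apply: f0; rewrite s0 sL.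
have fC : h^-1 *: (f (h *: 1 + s) - f s) @[h --> 0^'] --> 'D_1 f s by exact: fd.
have [sL'|] := ltP s L.
  have {}fC := cvg_dnbhs_at_right fC.
  rewrite -(cvg_lim _ fC)//; apply: lim_near_cst => //.
  near=> h; rewrite fs subr0 f0 ?scaler0// [_ *: _]mulr1.
  have h0 : 0 < h by near: h; exact: nbhs_right_gt.
  have h1 : h < L - s by near: h; apply: nbhs_right_lt; rewrite subr_gt0.
  by apply/andP; split; lra.
move=> Ls; have {Ls sL s0} sE : s = L by apply/le_anti; rewrite sL Ls.
have {}fC := cvg_dnbhs_at_left fC.
rewrite -(cvg_lim _ fC)//; apply: lim_near_cst => //.
near=> h; rewrite fs subr0 f0 ?scaler0// [_ *: _]mulr1.
have h0 : h < 0 by near: h; exact: nbhs_left_lt.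
have h1 : - L < h by near: h; apply: nbhs_left_gt; rewrite oppr_lt0.
by apply/andP; split; lra.
Unshelve. all: by end_near. Qed.

Lemma is_derive_agree_on_seg L (f g : R -> R) f' g' s : 0 < L ->
  (forall u, 0 <= u <= L -> f u = g u) -> 0 <= s <= L ->
  is_derive s 1 f f' -> is_derive s 1 g g' -> f' = g'.
Proof.
move=> L0 fg sL fD gD; apply/eqP; rewrite -subr_eq0; apply/eqP.
apply: (is_derive_zero_on_seg (f := f - g) L0 _ sL) => u uL.
by rewrite fctE /= fg// subrr.
Qed.

Lemma constant_on_seg L (f f' : R -> R) :
  (forall s, is_derive s 1 f (f' s)) -> (forall s, 0 <= s <= L -> f' s = 0) ->
  forall s, 0 <= s <= L -> f s = f 0.
Proof.
move=> fD f'0 s /andP[]; rewrite le_eqVlt => /predU1P[<- //|s0 sL].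
have fC : {within `[0, s], continuous f}.
  exact/continuous_subspaceT/is_derive_continuous.
have [c] := MVT s0 (fun x _ => fD x) fC.
rewrite in_itv /= => /andP[c0 cs] /eqP; rewrite f'0 ?mul0r ?subr_eq0.
  by move/eqP.
by rewrite (ltW c0) (ltW (lt_le_trans cs sL)).
Qed.

(** A primitive of [f] is monotone on the segment and takes the same value at
    both ends, so it is constant there. *)
Lemma integral_eq0_on_seg L (f : R -> R) : 0 < L -> continuous f ->
  (forall s, 0 <= s <= L -> 0 <= f s) -> \int[mu]_(s in `[0, L]) f s = 0 ->
  forall s, 0 <= s <= L -> f s = 0.
Proof.
move=> L0 fC f0 If s sL.
have [F F0 FD] := primitive_exists fC.
have FC := is_derive_continuous FD.
have FL : F L = 0.
  have := If; rewrite /Rintegral (@continuous_FTC2 R f F 0 L)//=.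
  - by rewrite F0 subr0.
  - exact: continuous_subspaceT.
  - split; [by move=> x _; exact: ex_derive
           | exact/cvg_at_right_filter/FC|exact/cvg_at_left_filter/FC].
  - by move=> x _; rewrite derive1E derive_val.
have Fmono : {in `[0, L] &, {homo F : x y / x <= y}}.
  apply: ger0_derive1_le.
  - by move=> x _; exact: ex_derive.
  - move=> x; rewrite in_itv /= => /andP[x0 xL].
    by rewrite derive1E derive_val f0// (ltW x0) (ltW xL).
  - exact: continuous_subspaceT.
apply: (is_derive_zero_on_seg (f := F) L0 _ sL) => // u uL.
case/andP: (uL) => u0 uL'.
apply/le_anti/andP; split.
- by rewrite -FL; apply: Fmono; rewrite // in_itv /= ?(ltW L0) ?lexx.
- by rewrite -F0; apply: Fmono; rewrite // in_itv /= ?(ltW L0) ?lexx.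
Qed.

End RealFunctions.

(** * The Lie algebra su2 *)

Section Su2Algebra.
Variable R : realType.
Local Notation M := 'M[R[i]]_2.
Implicit Types A B D X : M.

Lemma I2_cases (k : 'I_2) : k = 0 \/ k = 1.
Proof. by case: k => [[|[|k]] //= kP]; [left|right]; exact/val_inj. Qed.

Lemma mxtrace2E A : \tr A = A 0 0 + A 1 1.
Proof.
rewrite /mxtrace big_ord_recl big_ord_recl big_ord0 addr0.
by congr (_ + A _ _); apply/val_inj.
Qed.

Lemma innerE A B : inner A B =
  - 2 * complex.Re (A 0 0 * B 0 0 + A 0 1 * B 1 0 + (A 1 0 * B 0 1 + A 1 1 * B 1 1)).
Proof. by rewrite /inner mxtrace2E !mulmx2E. Qed.

Lemma innerDr A B D : inner A (B + D) = inner A B + inner A D.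
Proof. by rewrite /inner mulmxDr mxtraceD ReD mulrDr. Qed.

Lemma innerNr A B : inner A (- B) = - inner A B.
Proof. by rewrite /inner mulmxN raddfN ReN mulrN. Qed.

Lemma innerZr A (a : R) B : inner A (a%:C%C *: B) = a * inner A B.
Proof.
rewrite /inner -scalemxAr mxtraceZ ReM /= mul0r subr0.
by rewrite mulrCA.
Qed.

Lemma brkC A B : brk B A = - brk A B.
Proof. by rewrite /brk opprB. Qed.

Lemma brkDl A B D : brk (A + B) D = brk A D + brk B D.
Proof. by rewrite /brk mulmxDl mulmxDr opprD addrACA. Qed.

Lemma brkNl A D : brk (- A) D = - brk A D.
Proof. by rewrite /brk mulmxN mulNmx opprB opprK addrC. Qed.

Lemma brkZl (a : R) A B : brk (a%:C%C *: A) B = a%:C%C *: brk A B.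
Proof. by rewrite /brk -scalemxAl -scalemxAr scalerBr. Qed.

Lemma inner_brk_self A B : inner A (brk A B) = 0.
Proof.
by rewrite /inner /brk mulmxBr raddfB /= !mulmxA mxtrace_mulC mulmxA subrr mulr0.
Qed.

Lemma su2P A : su2 A -> exists a b c : R,
  [/\ A 0 0 = Complex 0 a, A 1 1 = Complex 0 (- a),
      A 0 1 = Complex b c & A 1 0 = Complex (- b) c].
Proof.
move=> [/matrixP Aadj]; rewrite mxtrace2E.
have := Aadj 0 0; have := Aadj 0 1;
  rewrite !adjE [X in _ = X]mxE [X in _ -> _ = X -> _]mxE.
case: (A 0 0) => [a a']; case: (A 1 1) => [d d'].
case: (A 0 1) => [b b']; case: (A 1 0) => [c c'].
move=> [eb ec] [ea] [ed ed'].
exists a', b, b'; split; congr Complex; lra.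
Qed.

(** Up to sign the bracket is the cross product of the Euclidean space [su2],
    and it occurs twice; this is Lagrange's identity. *)
Lemma inner_brk_brk A B : su2 A -> su2 B ->
  inner A (brk B (brk A B)) = inner A A * inner B B - inner A B ^+ 2.
Proof.
move=> /su2P[a [b [c [A00 A11 A01 A10]]]] /su2P[a' [b' [c' [B00 B11 B01 B10]]]].
rewrite !innerE /brk !(mulmx2E, mxE).
rewrite A00 A11 A01 A10 B00 B11 B01 B10 /=; ring.
Qed.

Lemma inner_su2_eq0 A : su2 A -> inner A A = 0 -> A = 0.
Proof.
move=> /su2P[a [b [c [A00 A11 A01 A10]]]].
rewrite innerE A00 A11 A01 A10 /= => E.
have {E} : a ^+ 2 + b ^+ 2 + c ^+ 2 = 0 by lra.
have := sqr_ge0 a; have := sqr_ge0 b; have := sqr_ge0 c => c2 b2 a2 E.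
have /eqP : a ^+ 2 = 0 by lra.
have /eqP : b ^+ 2 = 0 by lra.
have /eqP : c ^+ 2 = 0 by lra.
rewrite !sqrf_eq0 => /eqP c0 /eqP b0 /eqP a0.
apply/matrixP => i j; rewrite mxE.
by have [->|->] := I2_cases i; have [->|->] := I2_cases j;
  rewrite ?A00 ?A11 ?A01 ?A10 ?a0 ?b0 ?c0 ?oppr0.
Qed.

Lemma inner_ge0 A : su2 A -> 0 <= inner A A.
Proof.
move=> /su2P[a [b [c [A00 A11 A01 A10]]]].
rewrite innerE A00 A11 A01 A10 /=; nra.
Qed.

(** The triple product of three vectors in the plane orthogonal to the unit
    vector [A] vanishes. *)
Lemma inner_coplanar A B D E : su2 A -> su2 B -> su2 D -> su2 E ->
  inner A A = 1 -> inner A B = 0 -> inner A D = 0 -> inner A E = 0 ->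
  inner B (brk D E) = 0.
Proof.
move=> /su2P[a [b [c [A00 A11 A01 A10]]]] /su2P[a1 [b1 [c1 [B00 B11 B01 B10]]]].
move=> /su2P[a2 [b2 [c2 [D00 D11 D01 D10]]]] /su2P[a3 [b3 [c3 [E00 E11 E01 E10]]]].
rewrite !innerE A00 A11 A01 A10 B00 B11 B01 B10 D00 D11 D01 D10 E00 E11 E01 E10.
rewrite /brk !(mulmx2E, mxE).
rewrite D00 D11 D01 D10 E00 E11 E01 E10 /= => AA AB AD AE.
pose d := a1 * (b2 * c3 - c2 * b3) - b1 * (a2 * c3 - c2 * a3) +
  c1 * (a2 * b3 - b2 * a3).
have {}AB : a * a1 + b * b1 + c * c1 = 0 by lra.
have {}AD : a * a2 + b * b2 + c * c2 = 0 by lra.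
have {}AE : a * a3 + b * b3 + c * c3 = 0 by lra.
(* Cramer's rule: [d] times each coordinate of [A] is a combination of the
   three scalar products with [A]. *)
have da : a * d = 0.
  rewrite (_ : a * d = (a * a1 + b * b1 + c * c1) * (b2 * c3 - c2 * b3) -
    (a * a2 + b * b2 + c * c2) * (b1 * c3 - c1 * b3) +
    (a * a3 + b * b3 + c * c3) * (b1 * c2 - c1 * b2)); last by rewrite /d; ring.
  by rewrite AB AD AE !mul0r subrr addr0.
have db : b * d = 0.
  rewrite (_ : b * d = - (a * a1 + b * b1 + c * c1) * (a2 * c3 - c2 * a3) +
    (a * a2 + b * b2 + c * c2) * (a1 * c3 - c1 * a3) -
    (a * a3 + b * b3 + c * c3) * (a1 * c2 - c1 * a2)); last by rewrite /d; ring.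
  by rewrite AB AD AE oppr0 !mul0r addr0 subrr.
have dc : c * d = 0.
  rewrite (_ : c * d = (a * a1 + b * b1 + c * c1) * (a2 * b3 - b2 * a3) -
    (a * a2 + b * b2 + c * c2) * (a1 * b3 - b1 * a3) +
    (a * a3 + b * b3 + c * c3) * (a1 * b2 - b1 * a2)); last by rewrite /d; ring.
  by rewrite AB AD AE !mul0r subrr addr0.
have AA' : 4 * (a * a + b * b + c * c) = 1 by lra.
have d0 : d = 0.
  by rewrite -[d]mul1r -AA' -mulrA !mulrDl -!mulrA da db dc !(mulr0, addr0).
transitivity (- 8 * d); last by rewrite d0 mulr0.
by rewrite /d; ring.
Qed.

Lemma SU2_mulmx_adj X : SU2 X -> X *m X^t* = 1%:M /\ X^t* *m X = 1%:M.
Proof. by move=> [/unitarymxP XX _]; split=> //; exact: mulmx1C. Qed.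

Lemma invmx_SU2 X : SU2 X -> invmx X = X^t*.
Proof. by move=> [XU _]; exact: invmx_unitary. Qed.

Lemma adjM A B : (A *m B)^t* = B^t* *m A^t*.
Proof. by rewrite trmx_mul map_mxM. Qed.

Lemma su2_conj X A : SU2 X -> su2 A -> su2 (X *m A *m X^t*).
Proof.
move=> /SU2_mulmx_adj[XX X'X] [Aadj trA]; split.
  by rewrite !adjM trmxCK Aadj mulNmx mulmxN mulmxA.
by rewrite mxtrace_mulC mulmxA X'X mul1mx.
Qed.

Lemma su2_conjV X A : SU2 X -> su2 A -> su2 (X^t* *m A *m X).
Proof.
move=> /SU2_mulmx_adj[XX X'X] [Aadj trA]; split.
  by rewrite !adjM trmxCK Aadj mulNmx mulmxN mulmxA.
by rewrite mxtrace_mulC mulmxA XX mul1mx.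
Qed.

Lemma inner_conj X A B : SU2 X ->
  inner (X *m A *m X^t*) (X *m B *m X^t*) = inner A B.
Proof.
move=> /SU2_mulmx_adj[XX X'X]; rewrite /inner mxtrace_mulC; congr (_ * complex.Re _).
rewrite !mulmxA mxtrace_mulC !mulmxA X'X mul1mx.
rewrite -(mulmxA B) X'X mulmx1; exact: mxtrace_mulC.
Qed.

Lemma su2_brk A B : su2 A -> su2 B -> su2 (brk A B).
Proof.
move=> [Aa _] [Ba _]; split; last by rewrite /brk raddfB /= mxtrace_mulC subrr.
rewrite /brk linearB /= map_mxB !adjM Aa Ba !mulmxN !mulNmx !opprK opprB.
by [].
Qed.

Lemma A1E : [/\ A1 R 0 0 = Complex 0 2^-1, A1 R 1 1 = Complex 0 (- 2^-1),
  A1 R 0 1 = 0 & A1 R 1 0 = 0].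
Proof.
have half : (2^-1 : R[i]) = (2^-1 : R)%:C%C by rewrite fmorphV rmorph_nat.
rewrite /A1 half; split; rewrite !mxE /= ?mulr0 //.
- by rewrite expr0 mul1r; apply: complexP; rewrite ?ReM ?ImM /=; ring.
- by rewrite expr1; apply: complexP; rewrite ?ReM ?ImM /=; ring.
Qed.

Lemma su2_A1 : su2 (A1 R).
Proof.
have [A00 A11 A01 A10] := A1E; split.
  apply/matrixP => i j; rewrite adjE [RHS]mxE.
  have [->|->] := I2_cases i; have [->|->] := I2_cases j;
    rewrite ?A00 ?A11 ?A01 ?A10 ?conjc0 ?oppr0 //;
    apply: complexP => /=; rewrite ?oppr0 ?opprK //.
by rewrite mxtrace2E A00 A11; apply: complexP => /=; ring.
Qed.

Lemma inner_A1 : inner (A1 R) (A1 R) = 1.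
Proof.
by have [A00 A11 A01 A10] := A1E; rewrite innerE A00 A11 A01 A10 /=; field.
Qed.

End Su2Algebra.

(** * Curves and families of curves *)

Section Curves.
Variables (R : realType) (L : R).
Hypothesis L0 : 0 < L.
Local Notation M := 'M[R[i]]_2.
Implicit Types (t : R) (x v V U : curve L).

Lemma mx_smooth1_of_derives (g : nat -> R -> M) :
  (forall n t, mx_derives (g n) t (g n.+1 t)) -> mx_smooth1 (g 0%N).
Proof.
move=> gD a b; split.
- apply: (smooth1_of_derives (g := fun n t => complex.Re (g n t a b))) => n t.
  by have [] := gD n t a b.
- apply: (smooth1_of_derives (g := fun n t => complex.Im (g n t a b))) => n t.
  by have [] := gD n t a b.
Qed.

Lemma mx_smooth1_jet (f : R -> M) : mx_smooth1 f ->
  exists2 G, is_jet G & forall t s, G 0%N 0%N t s = f s.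
Proof.
move=> fS; pose D n s : M := \matrix_(a, b)
  Complex (derive1n n (fun u => complex.Re (f u a b)) s)
          (derive1n n (fun u => complex.Im (f u a b)) s).
have DD n s : mx_derives (D n) s (D n.+1 s).
  move=> a b; have [f1 f2] := fS a b.
  by split; under eq_fun do rewrite mxE /=; rewrite mxE /=;
    exact: smooth1_derives.
exists (fun i j _ s => if i is 0%N then D j s else 0 : M); last first.
  move=> _ s; apply/matrixP => a b; rewrite mxE /=.
  by case: (f s a b).
split=> [[|i] j t s|[|i] j t s|[|i] j] //; try exact: mx_derives_cst.
- move=> a b; split=> p.
  + apply: (@continuous_comp _ _ _ snd (fun u => complex.Re (D j u a b))).
      exact: cvg_snd.
    apply: (@is_derive_continuous _ _ (fun u => complex.Re (D j.+1 u a b))).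
    by move=> u; have [] := DD j u a b.
  + apply: (@continuous_comp _ _ _ snd (fun u => complex.Im (D j u a b))).
      exact: cvg_snd.
    apply: (@is_derive_continuous _ _ (fun u => complex.Im (D j.+1 u a b))).
    by move=> u; have [] := DD j u a b.
- exact: mx_continuous_cst.
Qed.

Lemma mx_smooth1_slice_s G i j t : is_jet G -> mx_smooth1 (G i j t).
Proof.
move=> [_ Gs _]; have := @mx_smooth1_of_derives (fun n => G i (n + j)%N t).
by apply => n u; exact: Gs.
Qed.

Lemma mx_derives_agree_on_seg (f g : R -> M) D E (s : seg L) :
  (forall u : seg L, f (val u) = g (val u)) ->
  mx_derives f (val s) D -> mx_derives g (val s) E -> D = E.
Proof.
move=> fg fD gE; apply/matrixP => a b.
have [f1 f2] := fD a b; have [g1 g2] := gE a b.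
apply: complexP.
- apply: is_derive_agree_on_seg L0 _ (valP s) f1 g1 => u uL.
  by have /= -> := fg (exist _ u uL).
- apply: is_derive_agree_on_seg L0 _ (valP s) f2 g2 => u uL.
  by have /= -> := fg (exist _ u uL).
Qed.

(** Two smooth extensions of a curve agree on the segment, hence so do their
    derivatives, end points included. *)
Lemma derivE (g : R -> M) x (s : seg L) D : mx_smooth1 g -> extends g x ->
  mx_derives g (val s) D -> deriv x s = D.
Proof.
move=> gS gx gD; rewrite /deriv.
set A := (X in xget _ X).
have : A (xget (fun _ : R => 0) A) by apply: (xgetPex _ (ex_intro _ g _)).
set h := xget _ _ => -[hS hx].
have hD : mx_derives h (val s) (mx_derive1 h (val s)).
  move=> a b; have [h1 h2] := hS a b.
  rewrite mxE; split => /=.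
  - by apply: DeriveDef; [exact: (h1 0%N)|rewrite derive1E].
  - by apply: DeriveDef; [exact: (h2 0%N)|rewrite derive1E].
by apply: (mx_derives_agree_on_seg (f := h) (g := g)) gD => // u; rewrite hx gx.
Qed.

Definition family_jet (G : jet R) (c : R -> curve L) : Prop :=
  is_jet G /\ forall t (s : seg L), G 0%N 0%N t (val s) = c t s.

Lemma smooth_family_jet c : smooth_family c -> exists G, family_jet G c.
Proof.
move=> [h [/is_jetP[G GJ <-] hc]]; exists G; split=> // t s; exact: hc.
Qed.

Lemma smooth_jet x : smooth x -> exists G, family_jet G (fun _ => x).
Proof.
move=> [g [/mx_smooth1_jet[G GJ GE] gx]]; exists G; split=> // t s.
by rewrite GE gx.
Qed.

Lemma family_jet_smooth1 G c t : family_jet G c -> smooth (c t).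
Proof.
move=> [GJ Gc]; exists (G 0%N 0%N t); split; first exact: mx_smooth1_slice_s.
by move=> s; rewrite Gc.
Qed.

Lemma family_jet_deriv G c t (s : seg L) : family_jet G c ->
  deriv (c t) s = G 0%N 1%N t (val s).
Proof.
move=> [GJ Gc]; apply: (derivE (g := G 0%N 0%N t)).
- exact: mx_smooth1_slice_s.
- by move=> u; rewrite Gc.
- by case: GJ.
Qed.

Lemma family_jet_velocity G c t (s : seg L) : family_jet G c ->
  velocity c t s = G 1%N 0%N t (val s).
Proof.
move=> [[Gt _ _] Gc]; apply: mx_derivesE => a b.
by under eq_fun do rewrite -Gc; exact: Gt.
Qed.

(** Freezing the first variable at [t0] after [i0] derivatives: the jet of a
    constant family, such as that of a velocity. *)
Definition jfix (G : jet R) i0 t0 : jet R :=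
  fun i j _ s => if i is 0%N then G i0 j t0 s else 0 : M.

Lemma is_jet_fix G i0 t0 : is_jet G -> is_jet (jfix G i0 t0).
Proof.
move=> [Gt Gs Gc]; split=> [[|i] j t s|[|i] j t s|[|i] j] /=;
  try exact: mx_derives_cst; try exact: mx_continuous_cst; first exact: Gs.
move=> a b; have [G1 G2] := Gc i0 j a b; split => p.
- apply: (@continuous_comp _ _ _ snd (fun u => complex.Re (G i0 j t0 u a b))).
    exact: cvg_snd.
  exact: (@continuous_slice _ (fun t u => complex.Re (G i0 j t u a b))).
- apply: (@continuous_comp _ _ _ snd (fun u => complex.Im (G i0 j t0 u a b))).
    exact: cvg_snd.
  exact: (@continuous_slice _ (fun t u => complex.Im (G i0 j t u a b))).
Qed.

Lemma family_jet_fix G c t : family_jet G c ->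
  family_jet (jfix G 0%N t) (fun _ => c t).
Proof. by move=> [GJ Gc]; split=> [|u s]; [exact: is_jet_fix|exact: Gc]. Qed.

Lemma family_jet_fix_velocity G c t : family_jet G c ->
  family_jet (jfix G 1%N t) (fun _ => velocity c t).
Proof.
move=> Gc; split=> [|u s]; first by apply: is_jet_fix; case: Gc.
by rewrite (family_jet_velocity _ _ Gc).
Qed.

Lemma integral_segE (f : seg L -> R) (phi : R -> R) :
  (forall s : seg L, f s = phi (val s)) ->
  integral_seg f = \int[@lebesgue_measure R]_(s in `[0, L]) phi s.
Proof.
move=> fphi; apply: eq_Rintegral => s; rewrite inE /= in_itv /= => sL.
by rewrite insubT /= fphi.
Qed.

(** The jet of the scalar function [inner (a 0 0) (b 0 0)]. *)
Definition jinner (a b : jet R) i j t s : R :=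
  - 2 * complex.Re (\tr (jmul a b i j t s)).

Lemma is_derive_Re_tr (f : R -> M) t D : mx_derives f t D ->
  is_derive t 1 (fun u => - 2 * complex.Re (\tr (f u))) (- 2 * complex.Re (\tr D)).
Proof.
move=> fD; rewrite (_ : (fun u => _) = - 2 \*: (fun u => complex.Re (f u 0 0 + f u 1 1))).
  rewrite mxtrace2E; apply: is_deriveZ.
  by have [] := cx_derivesD (fD 0 0) (fD 1 1).
by apply/funext => u; rewrite /= mxtrace2E.
Qed.

Lemma jinner_derives_t a b i j t s : is_jet a -> is_jet b ->
  is_derive t 1 (fun u => jinner a b i j u s) (jinner a b i.+1 j t s).
Proof. by move=> aJ bJ; apply: is_derive_Re_tr; case: (is_jetM aJ bJ). Qed.

Lemma jinner_continuous a b i j : is_jet a -> is_jet b ->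
  continuous (fun p : R * R => jinner a b i j p.1 p.2).
Proof.
move=> aJ bJ; have [_ _ abC] := is_jetM aJ bJ.
rewrite /jinner => p; rewrite (_ : (fun u => _) = (fun u : R * R => - 2 *
  (complex.Re (jmul a b i j u.1 u.2 0 0) + complex.Re (jmul a b i j u.1 u.2 1 1)))).
  have [r0 _] := abC i j 0 0; have [r1 _] := abC i j 1 1.
  by apply: cvgM; [exact: cvg_cst|apply: cvgD; [exact: r0|exact: r1]].
by apply/funext => u; rewrite mxtrace2E ReD.
Qed.

End Curves.

(** * The form along families of curves *)

Section FormOnJets.
Variables (R : realType) (L : R).
Hypothesis L0 : 0 < L.
Local Notation M := 'M[R[i]]_2.
Local Notation mu := (@lebesgue_measure R).
Implicit Types (t : R) (s : seg L) (x v V U : curve L) (a b : jet R).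

Lemma Lam_frame x F s : anchored_darboux x F ->
  Lam x s = F s *m A1 R *m (F s)^t*.
Proof.
move=> [_ xF _ xD]; have [xU _] := xF s; have [_ x'x] := SU2_mulmx_adj xU.
by rewrite /Lam (invmx_SU2 xU) xD !mulmxA x'x mul1mx.
Qed.

Lemma HorizD_Lam x s : HorizD x ->
  [/\ SU2 (x s), deriv x s = x s *m Lam x s, Lam x s = (x s)^t* *m deriv x s,
      su2 (Lam x s) & inner (Lam x s) (Lam x s) = 1].
Proof.
move=> [F xF]; have LamF := Lam_frame s xF.
have [_ /(_ s)[xU FU] _ xD] := xF.
split; first exact: xU.
- by rewrite xD LamF.
- by rewrite /Lam (invmx_SU2 xU).
- by rewrite LamF; exact: su2_conj FU (su2_A1 _).
- by rewrite LamF inner_conj // inner_A1.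
Qed.

Lemma tangentD_Upart x v V U : HorizD x -> tangent_data x v V U ->
  left_triv x v = V /\ Upart x v = U.
Proof.
move=> xH [_ _ _ VD vE].
have vV : left_triv x v = V.
  apply/funext => s; have [xU _ _ _ _] := HorizD_Lam s xH.
  have [_ x'x] := SU2_mulmx_adj xU.
  by rewrite /left_triv invmx_SU2// vE mulmxA x'x mul1mx.
split=> //; apply/funext => s; have [DV _] := VD s.
by rewrite /Upart vV DV addrC addKr.
Qed.

Definition jLam (H : jet R) : jet R := jmul (jadj H) (jds H).
Definition jbrk a b : jet R := jadd (jmul b a) (jopp (jmul a b)).

(** For unitary [X] with [X' = X Lam], [Upart X v = X^* (v' - v Lam)]. This
    formula is polynomial in [X], [v] and their adjoints, so it extends to
    jets. *)
Definition jU (H K : jet R) : jet R :=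
  jmul (jadj H) (jadd (jds K) (jopp (jmul K (jLam H)))).

Lemma is_jet_Lam H : is_jet H -> is_jet (jLam H).
Proof. by move=> HJ; apply: is_jetM; [exact: is_jet_adj|exact: is_jet_ds]. Qed.

Lemma is_jet_brk a b : is_jet a -> is_jet b -> is_jet (jbrk a b).
Proof.
by move=> aJ bJ; apply: is_jetD; [|apply: is_jetN]; exact: is_jetM.
Qed.

Lemma is_jet_U H K : is_jet H -> is_jet K -> is_jet (jU H K).
Proof.
move=> HJ KJ; apply: is_jetM; first exact: is_jet_adj.
apply: is_jetD; first exact: is_jet_ds.
by apply: is_jetN; apply: is_jetM => //; exact: is_jet_Lam.
Qed.

Lemma jLamE H c t s : family_jet H c -> HorizD (c t) ->
  Lam (c t) s = jLam H 0%N 0%N t (val s).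
Proof.
move=> Hc cH; have [_ _ -> _ _] := HorizD_Lam s cH.
by rewrite (family_jet_deriv L0 t s Hc) -(Hc.2 t s).
Qed.

(** The term [X'^* v] of the derivative of [X^* v] is [- Lam X^* v], because
    [Lam] is skew-Hermitian; it cancels one half of the bracket. *)
Lemma jUE H K c (v : R -> curve L) t s :
  family_jet H c -> family_jet K v -> HorizD (c t) ->
  Upart (c t) (v t) s = jU H K 0%N 0%N t (val s).
Proof.
move=> Hc Kv cH; have [cU cD cL [La _] _] := HorizD_Lam s cH.
have Jl : family_jet (jmul (jadj H) K) (fun t s => (c t s)^t* *m v t s).
  split=> [|u p]; first by apply: is_jetM; [apply: is_jet_adj; case: Hc|case: Kv].
  by rewrite -(Hc.2 u p) -(Kv.2 u p).
have vE : left_triv (c t) (v t) = (fun s => (c t s)^t* *m v t s).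
  apply/funext => p; have [pU _ _ _ _] := HorizD_Lam p cH.
  by rewrite /left_triv invmx_SU2.
have cJ : H 0%N 1%N t (val s) = c t s *m Lam (c t) s.
  by rewrite -(family_jet_deriv L0 t s Hc).
rewrite /Upart vE (family_jet_deriv L0 t s Jl).
transitivity ((c t s)^t* *m (K 0%N 1%N t (val s) - v t s *m Lam (c t) s)); last first.
  by rewrite (jLamE s Hc cH) -(Hc.2 t s) -(Kv.2 t s).
rewrite -[jmul _ _ _ _ _ _]/((H 0%N 1%N t (val s))^t* *m K 0%N 0%N t (val s) +
  (H 0%N 0%N t (val s))^t* *m K 0%N 1%N t (val s)).
rewrite cJ Hc.2 Kv.2 adjM La /brk mulmxBr !mulNmx !mulmxA opprB.
by rewrite addrACA addNr add0r.
Qed.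

(** The density of [- omega]. *)
Definition jomega (H K1 K2 : jet R) := jinner (jLam H) (jbrk (jU H K1) (jU H K2)).

Lemma omegaE H K1 K2 c (v w : R -> curve L) t : family_jet H c -> family_jet K1 v ->
  family_jet K2 w -> HorizD (c t) ->
  omega (c t) (v t) (w t) =
  - \int[mu]_(s in `[0, L]) jomega H K1 K2 0%N 0%N t s.
Proof.
move=> Hc Kv Kw cH; congr (- _); apply: integral_segE => s.
by rewrite (jLamE s Hc cH) (jUE s Hc Kv cH) (jUE s Hc Kw cH).
Qed.

Section Integrand.
Variables H K1 K2 : jet R.
Hypotheses (HJ : is_jet H) (K1J : is_jet K1) (K2J : is_jet K2).

Lemma jomega_continuous i j :
  continuous (fun p : R * R => jomega H K1 K2 i j p.1 p.2).
Proof.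
by apply: jinner_continuous; [exact: is_jet_Lam|apply: is_jet_brk; exact: is_jet_U].
Qed.

Lemma jomega_derives i j t u :
  is_derive t 1 (fun t => jomega H K1 K2 i j t u) (jomega H K1 K2 i.+1 j t u).
Proof.
by apply: jinner_derives_t; [exact: is_jet_Lam|apply: is_jet_brk; exact: is_jet_U].
Qed.

End Integrand.

Lemma dirD_omega H K1 K2 (c : R -> curve L) xi1 xi2 : family_jet H c ->
  family_jet K1 (fun t => xi1 (c t)) -> family_jet K2 (fun t => xi2 (c t)) ->
  (forall t, HorizD (c t)) ->
  dirD c (fun y => omega y (xi1 y) (xi2 y)) =
  - \int[mu]_(s in `[0, L]) jomega H K1 K2 1%N 0%N 0 s.
Proof.
move=> Hc K1c K2c cH; have [HJ _] := Hc; have [K1J _] := K1c; have [K2J _] := K2c.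
rewrite /dirD derive1E.
rewrite (_ : (fun t => _) = -
    (fun t => \int[mu]_(s in `[0, L]) jomega H K1 K2 0%N 0%N t s)).
  apply: derive_val; apply: is_deriveN.
  apply: is_derive_integral; try exact: jomega_continuous.
  by move=> t u; exact: jomega_derives.
by apply/funext => t; rewrite (omegaE Hc K1c K2c).
Qed.

End FormOnJets.

(** * The form is a smooth alternating 2-form *)

Section TwoForm.
Variables (R : realType) (L : R).
Hypothesis L0 : 0 < L.
Local Notation M := 'M[R[i]]_2.
Local Notation mu := (@lebesgue_measure R).
Implicit Types (t : R) (s : seg L) (x v V U : curve L) (a b : jet R).

Lemma integral_seg_lin (r : R) (f g h : R -> R) : continuous f -> continuous g ->
  (forall s, h (val s) = r * f (val s) + g (val s)) ->
  \int[mu]_(s in `[0, L]) h s =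
  r * \int[mu]_(s in `[0, L]) f s + \int[mu]_(s in `[0, L]) g s.
Proof.
move=> fC gC hE.
have fI := continuous_integrable 0 L fC; have gI := continuous_integrable 0 L gC.
rewrite -RintegralZl// -RintegralD//; last first.
  apply: continuous_integrable => p.
  by apply: cvgM; [exact: cvg_cst|exact: fC].
by apply: eq_Rintegral => s; rewrite inE /= in_itv /= => sL; exact: (hE (exist _ s sL)).
Qed.

Lemma integral_seg_eq0 (h : R -> R) : (forall s, h (val s) = 0) ->
  \int[mu]_(s in `[0, L]) h s = 0.
Proof.
move=> h0; have c0 : continuous (fun _ : R => 0 : R) by move=> p; exact: cvg_cst.
rewrite (integral_seg_lin (r := -1) c0 c0) => [|s]; first by rewrite mulN1r addNr.
by rewrite h0 mulr0 addr0.
Qed.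

Lemma tangent_jet x v : HorizD x -> tangentD x v ->
  exists K, family_jet K (fun _ => v).
Proof.
move=> [F [[xS _] _ _ _]] [V [U [[VS _] _ _ _ vE]]].
have [H [HJ Hx]] := smooth_jet xS; have [K [KJ KV]] := smooth_jet VS.
exists (jmul H K); split=> [|t s]; first exact: is_jetM.
by rewrite vE -(Hx t) -(KV t).
Qed.

Lemma HorizD_jet x : HorizD x -> exists K, family_jet K (fun _ => x).
Proof. by move=> [F [[xS _] _ _ _]]; exact: smooth_jet. Qed.

Lemma jomega_slice_continuous H K1 K2 i j t : is_jet H -> is_jet K1 -> is_jet K2 ->
  continuous (jomega H K1 K2 i j t).
Proof.
by move=> *; apply: continuous_slice; exact: jomega_continuous.
Qed.

Lemma jU_lin (r : R) (H K1 K2 : jet R) t u :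
  jU H (jadd (jmul (jcst r%:C%C%:M) K1) K2) 0%N 0%N t u =
  r%:C%C *: jU H K1 0%N 0%N t u + jU H K2 0%N 0%N t u.
Proof.
rewrite -[LHS]/((H 0%N 0%N t u)^t* *m (
  (0 *m K1 0%N 0%N t u + r%:C%C%:M *m K1 0%N 1%N t u + K2 0%N 1%N t u) -
  (r%:C%C%:M *m K1 0%N 0%N t u + K2 0%N 0%N t u) *m jLam H 0%N 0%N t u)).
rewrite -[X in _ = _ *: X + _]/((H 0%N 0%N t u)^t* *m
  (K1 0%N 1%N t u - K1 0%N 0%N t u *m jLam H 0%N 0%N t u)).
rewrite -[X in _ = _ + X]/((H 0%N 0%N t u)^t* *m
  (K2 0%N 1%N t u - K2 0%N 0%N t u *m jLam H 0%N 0%N t u)).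
rewrite mul0mx add0r !mul_scalar_mx mulmxDl -scalemxAl opprD addrACA.
by rewrite -scalerBr mulmxDr -scalemxAr.
Qed.

Lemma two_form_omega : two_form (@HorizD R L) (@tangentD R L) (@omega R L).
Proof.
split.
- move=> x v w xH /(tangent_jet xH)[Kv KvE] /(tangent_jet xH)[Kw KwE].
  have [H HE] := HorizD_jet xH.
  have E1 := omegaE L0 (t := 0) HE KvE KwE xH.
  have E2 := omegaE L0 (t := 0) HE KwE KvE xH.
  rewrite /= in E1 E2; rewrite E1 E2 opprK; apply/eqP; rewrite eq_sym -addr_eq0.
  apply/eqP; rewrite -[X in X + _]mul1r.
  rewrite -(integral_seg_lin (h := fun _ => 0)) ?integral_seg_eq0//.
  + by apply: jomega_slice_continuous; [case: HE|case: KvE|case: KwE].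
  + by apply: jomega_slice_continuous; [case: HE|case: KwE|case: KvE].
  + move=> s; rewrite mul1r -[jomega _ Kw _ _ _ _ _]/(inner _ (brk _ _)) addrC.
    by rewrite -[jomega _ Kv _ _ _ _ _]/(inner _ (brk _ _)) brkC innerNr addNr.
- move=> x r u v w xH /(tangent_jet xH)[Ku KuE] /(tangent_jet xH)[Kv KvE]
    /(tangent_jet xH)[Kw KwE].
  have [H HE] := HorizD_jet xH.
  pose K := jadd (jmul (jcst r%:C%C%:M) Ku) Kv.
  have KE : family_jet K (fun _ s => r%:C%C *: u s + v s).
    split=> [|t s].
      by apply: is_jetD; [apply: is_jetM; [exact: is_jet_cst|case: KuE]|case: KvE].
    rewrite -[LHS]/(r%:C%C%:M *m Ku 0%N 0%N t (val s) + Kv 0%N 0%N t (val s)).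
    by rewrite mul_scalar_mx KuE.2 KvE.2.
  have E1 := omegaE L0 (t := 0) HE KuE KwE xH.
  have E2 := omegaE L0 (t := 0) HE KvE KwE xH.
  have E3 := omegaE L0 (t := 0) HE KE KwE xH.
  rewrite /= in E1 E2 E3; rewrite E1 E2 E3 mulrN -opprD; congr (- _).
  apply: integral_seg_lin.
  + by apply: jomega_slice_continuous; [case: HE|case: KuE|case: KwE].
  + by apply: jomega_slice_continuous; [case: HE|case: KvE|case: KwE].
  + move=> s; rewrite -[LHS]/(inner _ (brk (jU H K _ _ _ _) _)).
    by rewrite jU_lin brkDl brkZl innerDr innerZr.
- move=> c v w [/smooth_family_jet[H HE] cH] /smooth_family_jet[Kv KvE] vT
    /smooth_family_jet[Kw KwE] wT.
  rewrite (_ : (fun t => _) = (fun t =>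
    - \int[mu]_(s in `[0, L]) jomega H Kv Kw 0%N 0%N t s)); last first.
    by apply/funext => t; rewrite (omegaE L0 HE KvE KwE).
  pose g n t := - \int[mu]_(s in `[0, L]) jomega H Kv Kw n 0%N t s.
  apply: (@smooth1_of_derives _ g) => n t; apply: is_deriveN.
  have jC m : continuous (fun p : R * R => jomega H Kv Kw m 0%N p.1 p.2).
    by apply: jomega_continuous; [case: HE|case: KvE|case: KwE].
  apply: is_derive_integral => // u p.
  by apply: jomega_derives; [case: HE|case: KvE|case: KwE].
Qed.

End TwoForm.

(** * The form is closed *)

Section ClosedForm.
Variables (R : realType) (L : R).
Hypothesis L0 : 0 < L.
Local Notation M := 'M[R[i]]_2.
Local Notation mu := (@lebesgue_measure R).
Implicit Types (t : R) (s : seg L) (x v V U : curve L) (a b : jet R).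

Lemma jet_at0 H (c : R -> curve L) s : family_jet H c ->
  [/\ H 0%N 0%N 0 (val s) = c 0 s, H 0%N 1%N 0 (val s) = deriv (c 0) s,
      H 1%N 0%N 0 (val s) = velocity c 0 s &
      H 1%N 1%N 0 (val s) = deriv (velocity c 0) s].
Proof.
move=> Hc; rewrite Hc.2 (family_jet_deriv L0 0 s Hc).
rewrite (family_jet_velocity 0 s Hc); split=> //.
by rewrite (family_jet_deriv L0 0 s (family_jet_fix_velocity 0 Hc)).
Qed.

Lemma tangent_su2 x v V U s : tangent_data x v V U ->
  su2 (U s) /\ inner (Lam x s) (U s) = 0.
Proof.
by move=> [_ /(_ s)[_ Us] _ /(_ s)[_ LU] _]; split; [exact: Us|exact: LU].
Qed.

(** The signs are those of the exterior derivative of a form that is minus an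
    integral. *)
Lemma alternating_integrals_eq0 (f1 f2 f3 f4 f5 f6 : R -> R) :
  continuous f1 -> continuous f2 -> continuous f3 ->
  continuous f4 -> continuous f5 -> continuous f6 ->
  (forall s, f1 (val s) - f2 (val s) + f3 (val s) - f4 (val s) + f5 (val s)
             - f6 (val s) = 0) ->
  - (\int[mu]_(s in `[0, L]) f1 s) - - (\int[mu]_(s in `[0, L]) f2 s) +
  - (\int[mu]_(s in `[0, L]) f3 s) - - (\int[mu]_(s in `[0, L]) f4 s) +
  - (\int[mu]_(s in `[0, L]) f5 s) - - (\int[mu]_(s in `[0, L]) f6 s) = 0.
Proof.
move=> C1 C2 C3 C4 C5 C6 f0.
have lC (r : R) (f g : R -> R) : continuous f -> continuous g ->
    continuous (fun u => r * f u + g u).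
  move=> fC gC u; apply: (@cvgD _ _ _ _ _ (fun u => r * f u) g); last exact: gC.
  by apply: (@cvgM _ _ _ _ (fun _ => r) f); [exact: cvg_cst|exact: fC].
pose g2 u := -1 * f2 u + f1 u; have G2 : continuous g2 by exact: lC.
pose g3 u := 1 * f3 u + g2 u; have G3 : continuous g3 by exact: lC.
pose g4 u := -1 * f4 u + g3 u; have G4 : continuous g4 by exact: lC.
pose g5 u := 1 * f5 u + g4 u; have G5 : continuous g5 by exact: lC.
have : \int[mu]_(s in `[0, L]) (-1 * f6 s + g5 s) = 0.
  apply: integral_seg_eq0 => s; rewrite -[RHS](f0 s) /g5 /g4 /g3 /g2.
  by move: (f1 _) (f2 _) (f3 _) (f4 _) (f5 _) (f6 _) => *; ring.
have e (h : R -> R) (p : seg L) : h (val p) = h (val p) by [].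
rewrite (integral_seg_lin C6 G5 (e _)) (integral_seg_lin (h := g5) C5 G4 (e _)).
rewrite (integral_seg_lin (h := g4) C4 G3 (e _)).
rewrite (integral_seg_lin (h := g3) C3 G2 (e _)).
rewrite (integral_seg_lin (h := g2) C2 C1 (e _)).
by lra.
Qed.

Lemma jomega10 (H K1 K2 : jet R) t u :
  jomega H K1 K2 1%N 0%N t u =
  inner (jLam H 1%N 0%N t u) (brk (jU H K1 0%N 0%N t u) (jU H K2 0%N 0%N t u)) +
  inner (jLam H 0%N 0%N t u) (brk (jU H K1 1%N 0%N t u) (jU H K2 0%N 0%N t u) +
                              brk (jU H K1 0%N 0%N t u) (jU H K2 1%N 0%N t u)).
Proof.
set l1 := jLam H 1%N 0%N t u; set l0 := jLam H 0%N 0%N t u.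
set a0 := jU H K1 0%N 0%N t u; set a1 := jU H K1 1%N 0%N t u.
set b0 := jU H K2 0%N 0%N t u; set b1 := jU H K2 1%N 0%N t u.
rewrite -[LHS]/(- 2 * complex.Re (\tr (l1 *m (b0 *m a0 - a0 *m b0) +
  l0 *m ((b1 *m a0 + b0 *m a1) - (a1 *m b0 + a0 *m b1))))).
rewrite mxtraceD ReD mulrDr; congr (_ + - 2 * complex.Re (\tr (_ *m _))).
by rewrite /brk opprD [b1 *m a0 + _]addrC addrACA.
Qed.

(** The velocity of [Lam] is [U], and the velocity of [Upart X (xi X)] is the
    value of the same expression at the velocity of [xi X], up to a term
    symmetric in the two tangent vectors: [V U2] comes from varying the factor
    [X^*], and [V2 U] from varying [Lam]. *)
Lemma jU_variation H K (c : R -> curve L) (xi : curve L -> curve L) V U V2 U2 s :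
  family_jet H c -> family_jet K (fun t => xi (c t)) -> HorizD (c 0) ->
  tangent_data (c 0) (velocity c 0) V U -> tangent_data (c 0) (xi (c 0)) V2 U2 ->
  [/\ jLam H 0%N 0%N 0 (val s) = Lam (c 0) s,
      jLam H 1%N 0%N 0 (val s) = U s,
      jU H K 0%N 0%N 0 (val s) = U2 s &
      jU H K 1%N 0%N 0 (val s) = - (V s *m U2 s + V2 s *m U s) +
        (c 0 s)^t* *m (deriv (dirDv c xi) s - dirDv c xi s *m Lam (c 0) s)].
Proof.
move=> Hc Kc cH vT xiT.
have [cU cD cL [La _] _] := HorizD_Lam s cH.
have [cc c'c] := SU2_mulmx_adj cU.
have [H00 H01 H10 H11] := jet_at0 s Hc.
have [K00 K01 K10 K11] := jet_at0 s Kc; rewrite -/(dirDv c xi) in K10 K11.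
have L00 : jLam H 0%N 0%N 0 (val s) = Lam (c 0) s by rewrite (jLamE L0 s Hc cH).
have U00 : jU H K 0%N 0%N 0 (val s) = U2 s.
  by rewrite -(jUE L0 s Hc Kc cH); have [_ ->] := tangentD_Upart cH xiT.
have vE u : velocity c 0 u = c 0 u *m V u by case: vT.
have xiE u : xi (c 0) u = c 0 u *m V2 u by case: xiT.
have [Va _] : su2 (V s) by case: vT => [_ /(_ s)[]].
have vJ := family_jet_fix_velocity 0 Hc.
have UE : U s = (c 0 s)^t* *m (deriv (velocity c 0) s - velocity c 0 s *m Lam (c 0) s).
  have [_ <-] := tangentD_Upart cH vT.
  rewrite (jUE L0 (t := 0) s (family_jet_fix 0 Hc) vJ cH).
  rewrite -[LHS]/((H 0%N 0%N 0 (val s))^t* *m (H 1%N 1%N 0 (val s) -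
    H 1%N 0%N 0 (val s) *m jLam H 0%N 0%N 0 (val s))).
  by rewrite H00 H10 H11 L00.
have U2E : U2 s = (c 0 s)^t* *m (deriv (xi (c 0)) s - xi (c 0) s *m Lam (c 0) s).
  rewrite -U00 -[LHS]/((H 0%N 0%N 0 (val s))^t* *m (K 0%N 1%N 0 (val s) -
    K 0%N 0%N 0 (val s) *m jLam H 0%N 0%N 0 (val s))).
  by rewrite H00 K00 K01 L00.
have L10 : jLam H 1%N 0%N 0 (val s) = U s.
  rewrite -[LHS]/((H 1%N 0%N 0 (val s))^t* *m H 0%N 1%N 0 (val s) +
    (H 0%N 0%N 0 (val s))^t* *m H 1%N 1%N 0 (val s)).
  rewrite H10 H01 H00 H11 UE vE cD adjM Va mulmxBr !mulNmx !mulmxA.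
  by rewrite -(mulmxA (V s)) c'c mulmx1 mul1mx addrC.
split; [exact: L00|exact: L10|exact: U00|].
rewrite -[LHS]/((H 1%N 0%N 0 (val s))^t* *m (K 0%N 1%N 0 (val s) -
    K 0%N 0%N 0 (val s) *m jLam H 0%N 0%N 0 (val s)) +
  (H 0%N 0%N 0 (val s))^t* *m (K 1%N 1%N 0 (val s) -
    (K 1%N 0%N 0 (val s) *m jLam H 0%N 0%N 0 (val s) +
     K 0%N 0%N 0 (val s) *m jLam H 1%N 0%N 0 (val s)))).
rewrite H10 K01 K00 L00 H00 K11 K10 L10 vE adjM Va -mulmxA -U2E mulNmx.
rewrite xiE opprD addrA mulmxDr addrA mulmxN !mulmxA c'c mul1mx opprD.
by rewrite addrAC.
Qed.

(** Here [e_ij] stands for the derivative of [u_j] along the [i]-th path, so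
    that [e_ij - e_ji] is the [U] of a Lie bracket. Each [e_ij] occurs twice,
    with opposite signs. *)
Lemma exterior_derivative_cancels (l u1 u2 u3 e12 e13 e21 e23 e31 e32 : M) :
  inner u1 (brk u2 u3) = 0 -> inner u2 (brk u1 u3) = 0 ->
  inner u3 (brk u1 u2) = 0 ->
  inner u1 (brk u2 u3) + inner l (brk e12 u3 + brk u2 e13)
  - (inner u2 (brk u1 u3) + inner l (brk e21 u3 + brk u1 e23))
  + (inner u3 (brk u1 u2) + inner l (brk e31 u2 + brk u1 e32))
  - inner l (brk (e12 - e21) u3) + inner l (brk (e13 - e31) u2)
  - inner l (brk (e23 - e32) u1) = 0.
Proof.
have TB (a b d : M) : inner l (brk (a - b) d) = inner l (brk a d) - inner l (brk b d).
  by rewrite brkDl brkNl innerDr innerNr.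
have TC (a b d e : M) :
    inner l (brk a b + brk d e) = inner l (brk a b) - inner l (brk e d).
  by rewrite (brkC e d) innerDr innerNr.
move=> -> -> ->; rewrite (TC e12) (TC e21) (TC e31) (TB e12) (TB e13) (TB e23).
move: (inner l (brk e12 u3)) (inner l (brk e13 u2)) (inner l (brk e21 u3)).
move: (inner l (brk e23 u1)) (inner l (brk e31 u2)) (inner l (brk e32 u1)).
by move=> *; ring.
Qed.

(** The formula is evaluated under the integral sign, one value of [s] at a
    time. *)
Lemma closed_omega (O : set (curve L)) xi1 xi2 xi3 : O `<=` @HorizD R L ->
  vector_field (@tangentD R L) O xi1 -> vector_field (@tangentD R L) O xi2 ->
  vector_field (@tangentD R L) O xi3 -> forall x c1 c2 c3, O x ->
  path_of O x (xi1 x) c1 -> path_of O x (xi2 x) c2 -> path_of O x (xi3 x) c3 ->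
  ext_deriv (@omega R L) x xi1 xi2 xi3 c1 c2 c3 = 0.
Proof.
move=> OH [T1 S1] [T2 S2] [T3 S3] x c1 c2 c3 Ox.
move=> [p1 c10 v1] [p2 c20 v2] [p3 c30 v3].
have xH := OH _ Ox.
have [/smooth_family_jet[H1 H1E] O1] := p1.
have [/smooth_family_jet[H2 H2E] O2] := p2.
have [/smooth_family_jet[H3 H3E] O3] := p3.
have [K12 K12E] := smooth_family_jet (S2 _ p1).
have [K13 K13E] := smooth_family_jet (S3 _ p1).
have [K21 K21E] := smooth_family_jet (S1 _ p2).
have [K23 K23E] := smooth_family_jet (S3 _ p2).
have [K31 K31E] := smooth_family_jet (S1 _ p3).
have [K32 K32E] := smooth_family_jet (S2 _ p3).
(* The jet of the Lie bracket of two fields along their paths. *)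
pose br (a b : jet R) := jadd (jfix a 1%N 0) (jopp (jfix b 1%N 0)).
have brE a b (c d : R -> curve L) : family_jet a c -> family_jet b d ->
    family_jet (br a b) (fun _ s => velocity c 0 s - velocity d 0 s).
  move=> aE bE; split=> [|t s].
    by apply: is_jetD; [|apply: is_jetN]; apply: is_jet_fix; [case: aE|case: bE].
  by rewrite (family_jet_velocity _ _ aE) (family_jet_velocity _ _ bE).
(* [x] and the values of the fields at [x], as constant families. *)
have XE := family_jet_fix 0 H1E; rewrite c10 in XE.
have Y1E := family_jet_fix 0 K21E; rewrite c20 in Y1E.
have Y2E := family_jet_fix 0 K12E; rewrite c10 in Y2E.
have Y3E := family_jet_fix 0 K13E; rewrite c10 in Y3E.
have B12 := brE _ _ _ _ K12E K21E.
have B13 := brE _ _ _ _ K13E K31E.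
have B23 := brE _ _ _ _ K23E K32E.
rewrite /ext_deriv.
rewrite (dirD_omega L0 H1E K12E K13E (fun t => OH _ (O1 t))).
rewrite (dirD_omega L0 H2E K21E K23E (fun t => OH _ (O2 t))).
rewrite (dirD_omega L0 H3E K31E K32E (fun t => OH _ (O3 t))).
have E4 := omegaE L0 (t := 0) XE B12 Y3E xH.
have E5 := omegaE L0 (t := 0) XE B13 Y2E xH.
have E6 := omegaE L0 (t := 0) XE B23 Y1E xH.
rewrite /lie_bracket /dirDv; rewrite /= in E4 E5 E6; rewrite E4 E5 E6.
have [V1 [U1 D1]] := T1 _ Ox; have [V2 [U2 D2]] := T2 _ Ox.
have [V3 [U3 D3]] := T3 _ Ox.
have jC H K K' i : is_jet H -> is_jet K -> is_jet K' ->
    continuous (jomega H K K' i 0%N 0).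
  by move=> *; exact: jomega_slice_continuous.
have [H1J _] := H1E; have [H2J _] := H2E; have [H3J _] := H3E.
have [K12J _] := K12E; have [K13J _] := K13E; have [K21J _] := K21E.
have [K23J _] := K23E; have [K31J _] := K31E; have [K32J _] := K32E.
have [XJ _] := XE; have [Y1J _] := Y1E; have [Y2J _] := Y2E; have [Y3J _] := Y3E.
have [B12J _] := B12; have [B13J _] := B13; have [B23J _] := B23.
set f1 := jomega H1 K12 K13 1%N 0%N 0; set f2 := jomega H2 K21 K23 1%N 0%N 0.
set f3 := jomega H3 K31 K32 1%N 0%N 0.
set f4 := jomega (jfix H1 0%N 0) (br K12 K21) (jfix K13 0%N 0) 0%N 0%N 0.
set f5 := jomega (jfix H1 0%N 0) (br K13 K31) (jfix K12 0%N 0) 0%N 0%N 0.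
set f6 := jomega (jfix H1 0%N 0) (br K23 K32) (jfix K21 0%N 0) 0%N 0%N 0.
have f1C : continuous f1 by exact: jC.
have f2C : continuous f2 by exact: jC.
have f3C : continuous f3 by exact: jC.
have f4C : continuous f4 by exact: jC.
have f5C : continuous f5 by exact: jC.
have f6C : continuous f6 by exact: jC.
apply: alternating_integrals_eq0 => // s.
(* From here on [s] is fixed, and everything is linear algebra in [su2]. *)
have vT1 : tangent_data (c1 0) (velocity c1 0) V1 U1 by rewrite v1 c10.
have vT2 : tangent_data (c2 0) (velocity c2 0) V2 U2 by rewrite v2 c20.
have vT3 : tangent_data (c3 0) (velocity c3 0) V3 U3 by rewrite v3 c30.
have c1H : HorizD (c1 0) by rewrite c10.
have c2H : HorizD (c2 0) by rewrite c20.
have c3H : HorizD (c3 0) by rewrite c30.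
have D12 : tangent_data (c1 0) (xi2 (c1 0)) V2 U2 by rewrite c10.
have D13 : tangent_data (c1 0) (xi3 (c1 0)) V3 U3 by rewrite c10.
have D21 : tangent_data (c2 0) (xi1 (c2 0)) V1 U1 by rewrite c20.
have D23 : tangent_data (c2 0) (xi3 (c2 0)) V3 U3 by rewrite c20.
have D31 : tangent_data (c3 0) (xi1 (c3 0)) V1 U1 by rewrite c30.
have D32 : tangent_data (c3 0) (xi2 (c3 0)) V2 U2 by rewrite c30.
have [l1 dl1 u12 e12] := jU_variation s H1E K12E c1H vT1 D12.
have [_ _ u13 e13] := jU_variation s H1E K13E c1H vT1 D13.
have [l2 dl2 u21 e21] := jU_variation s H2E K21E c2H vT2 D21.
have [_ _ u23 e23] := jU_variation s H2E K23E c2H vT2 D23.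
have [l3 dl3 u31 e31] := jU_variation s H3E K31E c3H vT3 D31.
have [_ _ u32 e32] := jU_variation s H3E K32E c3H vT3 D32.
rewrite c10 in l1 e12 e13; rewrite c20 in l2 e21 e23; rewrite c30 in l3 e31 e32.
have [H00 _ _ _] := jet_at0 s H1E; rewrite c10 in H00.
have AC (p q r t : M) : (p - q) - (r - t) = (p - r) - (q - t).
  by rewrite !opprB addrACA [RHS]addrACA; congr (_ + _); exact: addrC.
have brU a b (c d : R -> curve L) : family_jet a c -> family_jet b d ->
    jU (jfix H1 0%N 0) (br a b) 0%N 0%N 0 (val s) =
    (x s)^t* *m (deriv (velocity c 0) s - velocity c 0 s *m Lam x s) -
    (x s)^t* *m (deriv (velocity d 0) s - velocity d 0 s *m Lam x s).
  move=> aE bE; have [_ _ a10 a11] := jet_at0 s aE.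
  have [_ _ b10 b11] := jet_at0 s bE.
  rewrite -[LHS]/((H1 0%N 0%N 0 (val s))^t* *m
    ((a 1%N 1%N 0 (val s) - b 1%N 1%N 0 (val s)) -
     (a 1%N 0%N 0 (val s) - b 1%N 0%N 0 (val s)) *m jLam H1 0%N 0%N 0 (val s))).
  rewrite H00 l1 a10 a11 b10 b11 -mulmxBr mulmxBl.
  by congr (_ *m _); exact: AC.
(* The symmetric terms of [jU_variation] cancel in the Lie bracket. *)
have sym (A B C D : M) : (- (A + B) + C) - (- (B + A) + D) = C - D.
  rewrite [B + A]addrC; move: (- (A + B)) => E.
  by rewrite opprD addrACA subrr add0r.
have b12 : jU (jfix H1 0%N 0) (br K12 K21) 0%N 0%N 0 (val s) =
    jU H1 K12 1%N 0%N 0 (val s) - jU H2 K21 1%N 0%N 0 (val s).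
  by rewrite (brU _ _ _ _ K12E K21E) e12 e21; exact/esym/sym.
have b13 : jU (jfix H1 0%N 0) (br K13 K31) 0%N 0%N 0 (val s) =
    jU H1 K13 1%N 0%N 0 (val s) - jU H3 K31 1%N 0%N 0 (val s).
  by rewrite (brU _ _ _ _ K13E K31E) e13 e31; exact/esym/sym.
have b23 : jU (jfix H1 0%N 0) (br K23 K32) 0%N 0%N 0 (val s) =
    jU H2 K23 1%N 0%N 0 (val s) - jU H3 K32 1%N 0%N 0 (val s).
  by rewrite (brU _ _ _ _ K23E K32E) e23 e32; exact/esym/sym.
rewrite /f1 /f2 /f3 !jomega10 l1 l2 l3 dl1 dl2 dl3 u12 u13 u21 u23 u31 u32.
have B0 K K' : jomega (jfix H1 0%N 0) K K' 0%N 0%N 0 (val s) =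
    inner (jLam H1 0%N 0%N 0 (val s)) (brk (jU (jfix H1 0%N 0) K 0%N 0%N 0 (val s))
      (jU (jfix H1 0%N 0) K' 0%N 0%N 0 (val s))) by [].
rewrite /f4 /f5 /f6 !B0 l1 b12 b13 b23.
have y1 : jU (jfix H1 0%N 0) (jfix K21 0%N 0) 0%N 0%N 0 (val s) = U1 s.
  by rewrite -(jUE L0 (t := 0) s XE Y1E xH); have [_ ->] := tangentD_Upart xH D1.
have y2 : jU (jfix H1 0%N 0) (jfix K12 0%N 0) 0%N 0%N 0 (val s) = U2 s.
  by rewrite -(jUE L0 (t := 0) s XE Y2E xH); have [_ ->] := tangentD_Upart xH D2.
have y3 : jU (jfix H1 0%N 0) (jfix K13 0%N 0) 0%N 0%N 0 (val s) = U3 s.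
  by rewrite -(jUE L0 (t := 0) s XE Y3E xH); have [_ ->] := tangentD_Upart xH D3.
rewrite y1 y2 y3.
have [_ _ _ Lsu LL] := HorizD_Lam s xH.
have [su1 p1'] : su2 (U1 s) /\ inner (Lam x s) (U1 s) = 0.
  exact: tangent_su2 D1.
have [su2' p2'] : su2 (U2 s) /\ inner (Lam x s) (U2 s) = 0.
  exact: tangent_su2 D2.
have [su3 p3'] : su2 (U3 s) /\ inner (Lam x s) (U3 s) = 0.
  exact: tangent_su2 D3.
apply: exterior_derivative_cancels.
- exact: (inner_coplanar Lsu su1 su2' su3 LL).
- exact: (inner_coplanar Lsu su2' su1 su3 LL).
- exact: (inner_coplanar Lsu su3 su1 su2' LL).
Qed.

End ClosedForm.

(** * The form is non-degenerate *)

Section Nondegenerate.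
Variables (R : realType) (L : R).
Hypothesis L0 : 0 < L.
Local Notation M := 'M[R[i]]_2.
Implicit Types (t : R) (s : seg L) (x v V U : curve L) (a b : jet R).

Lemma cx_constant_on_seg (f f' : R -> R[i]) :
  (forall u, cx_derives f u (f' u)) -> (forall s, f' (val s) = 0) ->
  forall s, f (val s) = f 0.
Proof.
move=> fD f0 s; apply: complexP.
- apply: (@constant_on_seg _ L (fun u => complex.Re (f u))
    (fun u => complex.Re (f' u)) _ _ _ (valP s)).
    by move=> u; have [] := fD u.
  by move=> u uL; have /= -> := f0 (exist _ u uL).
- apply: (@constant_on_seg _ L (fun u => complex.Im (f u))
    (fun u => complex.Im (f' u)) _ _ _ (valP s)).
    by move=> u; have [] := fD u.
  by move=> u uL; have /= -> := f0 (exist _ u uL).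
Qed.

Lemma mx_constant_on_seg (f f' : R -> M) :
  (forall u, mx_derives f u (f' u)) -> (forall s, f' (val s) = 0) ->
  forall s, f (val s) = f 0.
Proof.
move=> fD f0 s; apply/matrixP => a b.
apply: (@cx_constant_on_seg (fun u => f u a b) (fun u => f' u a b)) => [u|p].
  exact: fD.
by rewrite f0 mxE.
Qed.

Lemma mx_primitive_exists (f : R -> M) : mx_continuous f ->
  exists2 W : R -> M, W 0 = 0 & forall u, mx_derives W u (f u).
Proof.
move=> fC.
have /choice[F FP] : forall ab : 'I_2 * 'I_2, exists F : R -> R[i],
    F 0 = 0 /\ forall u, cx_derives F u (f u ab.1 ab.2).
  move=> [a b]; have [fr fi] := fC a b.
  have [Fr r0 rD] := primitive_exists fr; have [Fi i0 iD] := primitive_exists fi.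
  exists (fun u => Complex (Fr u) (Fi u)); split; first by rewrite r0 i0.
  by move=> u; split; [exact: rD|exact: iD].
exists (fun u => \matrix_(a, b) F (a, b) u).
  by apply/matrixP => a b; rewrite !mxE; have [] := FP (a, b).
move=> u a b; rewrite (_ : (fun u => _) = F (a, b)).
  by have [_ /(_ u)] := FP (a, b).
by apply/funext => p; rewrite mxE.
Qed.

Lemma family_jet_uniq_derives (G : jet R) (W f : R -> M) : is_jet G ->
  (forall t u, G 0%N 0%N t u = W u) -> (forall u, mx_derives W u (f u)) ->
  forall t u, G 0%N 1%N t u = f u.
Proof.
move=> [_ Gs _] GW WD t u; apply: mx_derives_uniq (WD u).
by rewrite (_ : W = G 0%N 0%N t)//; apply/funext => p; rewrite GW.
Qed.

(** Variation of constants: [V = X^* W X] solves [V' = [Lam, V] + U] as soon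
    as [W] is a primitive of [X U X^*], and [W] stays in [su2] because its
    derivative does. *)
Lemma tangent_lift x U : HorizD x -> smooth U -> (forall s, su2 (U s)) ->
  starts_at U 0 -> (forall s, inner (Lam x s) (U s) = 0) ->
  exists w V, tangent_data x w V U.
Proof.
move=> xH US Usu U0 LU.
have [X XE] := HorizD_jet xH; have [K KE] := smooth_jet US.
have [XJ Xx] := XE; have [KJ KU] := KE.
pose f := jmul (jmul X K) (jadj X).
have fJ : is_jet f by apply: is_jetM; [exact: is_jetM|exact: is_jet_adj].
have fE s : f 0%N 0%N 0 (val s) = x s *m U s *m (x s)^t*.
  by rewrite -(Xx 0 s) -(KU 0 s).
have f0C : mx_continuous (f 0%N 0%N 0).
  have [_ _ fC] := fJ; move=> a b; have [fr fi] := fC 0%N 0%N a b.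
  by split; [exact: (@continuous_slice _ (fun t u => complex.Re (f 0%N 0%N t u a b)))
            |exact: (@continuous_slice _ (fun t u => complex.Im (f 0%N 0%N t u a b)))].
have [W W0 WD] := mx_primitive_exists f0C.
have WS : mx_smooth1 W.
  apply: (@mx_smooth1_of_derives _ (fun n => if n is m.+1 then f 0%N m 0 else W)).
  by move=> [|n] u; [exact: WD|case: fJ].
have [J JJ JW] := mx_smooth1_jet WS.
have J1 := family_jet_uniq_derives JJ JW WD.
have Wsu s : su2 (W (val s)).
  split.
    apply/eqP; rewrite -addr_eq0 addrC; apply/eqP.
    rewrite (@mx_constant_on_seg (fun u => W u + (W u)^t*)
      (fun u => f 0%N 0%N 0 u + (f 0%N 0%N 0 u)^t*)).
    - by rewrite W0 trmx0 map_mx0 addr0.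
    - by move=> u; apply: mx_derivesD; [|apply: mx_derives_adj]; exact: WD.
    - move=> p; rewrite fE; have [pU _ _ _ _] := HorizD_Lam p xH.
      by have [-> _] := su2_conj pU (Usu p); rewrite subrr.
  rewrite mxtrace2E (@cx_constant_on_seg (fun u => W u 0 0 + W u 1 1)
      (fun u => f 0%N 0%N 0 u 0 0 + f 0%N 0%N 0 u 1 1)).
  - by rewrite W0 !mxE addr0.
  - by move=> u; apply: cx_derivesD; exact: WD.
  - move=> p; rewrite fE -mxtrace2E; have [pU _ _ _ _] := HorizD_Lam p xH.
    by have [] := su2_conj pU (Usu p).
pose V : curve L := fun s => (x s)^t* *m W (val s) *m x s.
have VE : family_jet (jmul (jmul (jadj X) J) X) (fun _ => V).
  split=> [|t s].
    by apply: is_jetM => //; apply: is_jetM => //; exact: is_jet_adj.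
  by rewrite -[LHS]/((X 0%N 0%N t (val s))^t* *m J 0%N 0%N t (val s) *m
    X 0%N 0%N t (val s)) Xx JW.
exists (fun s => x s *m V s), V; split.
- by split=> //; exact: (family_jet_smooth1 0 VE).
- move=> s; split; last exact: Usu.
  by have [pU _ _ _ _] := HorizD_Lam s xH; exact: su2_conjV.
- by split=> // s s0; rewrite /V s0 W0 mulmx0 mul0mx.
- move=> s; split; last exact: LU.
  have [xU xD _ [La _] _] := HorizD_Lam s xH; have [xx x'x] := SU2_mulmx_adj xU.
  rewrite (family_jet_deriv L0 0 s VE).
  rewrite -[LHS]/(((X 0%N 1%N 0 (val s))^t* *m J 0%N 0%N 0 (val s) +
      (X 0%N 0%N 0 (val s))^t* *m J 0%N 1%N 0 (val s)) *m X 0%N 0%N 0 (val s) +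
    (X 0%N 0%N 0 (val s))^t* *m J 0%N 0%N 0 (val s) *m X 0%N 1%N 0 (val s)).
  rewrite J1 fE JW Xx -(family_jet_deriv L0 0 s XE) xD adjM La.
  rewrite !mulNmx mulmxDl !mulmxA x'x mul1mx mulNmx -(mulmxA (U s)) x'x mulmx1.
  by rewrite /brk /V !mulmxA addrAC; congr (_ + _); exact: addrC.
- by [].
Qed.

Lemma brk_smooth x U : HorizD x -> smooth U -> smooth (fun s => brk (Lam x s) (U s)).
Proof.
move=> xH US; have [X XE] := HorizD_jet xH; have [K KE] := smooth_jet US.
have [XJ _] := XE; have [KJ KU] := KE.
have E : family_jet (jbrk (jLam X) K) (fun _ s => brk (Lam x s) (U s)).
  split=> [|t s]; first by apply: is_jet_brk => //; exact: is_jet_Lam.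
  rewrite -[LHS]/(brk (jLam X 0%N 0%N t (val s)) (K 0%N 0%N t (val s))).
  by rewrite -(jLamE L0 (t := t) s XE xH) KU.
exact: (family_jet_smooth1 0 E).
Qed.

(** The hypothesis is restricted to one test direction, so that the lemma
    applies both with and without periodicity. *)
Lemma nondegenerate_omega x v V U : HorizD x -> tangent_data x v V U ->
  (forall w W, tangent_data x w W (fun s => brk (Lam x s) (U s)) -> omega x v w = 0) ->
  v = (fun _ => 0).
Proof.
move=> xH vT H; have [_ vU] := tangentD_Upart xH vT.
have [[VS US] Vsu [V0 U0] VD vE] := vT.
have [w [W wT]] : exists w W, tangent_data x w W (fun s => brk (Lam x s) (U s)).
  apply: tangent_lift => //.
  - exact: brk_smooth.
  - move=> s; have [_ _ _ Lsu _] := HorizD_Lam s xH.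
    by apply: su2_brk => //; have [] := Vsu s.
  - by move=> s s0; rewrite (U0 s s0) /brk mul0mx mulmx0 subrr.
  - by move=> s; exact: inner_brk_self.
have [_ wU] := tangentD_Upart xH wT.
have [X XE] := HorizD_jet xH; have [KU [KUJ KUE]] := smooth_jet US.
have [K KE] := tangent_jet xH (ex_intro _ V (ex_intro _ U vT)).
have uC : continuous (jinner KU KU 0%N 0%N 0).
  by apply: continuous_slice; exact: jinner_continuous.
have uE s : jinner KU KU 0%N 0%N 0 (val s) = inner (U s) (U s).
  by rewrite -(KUE 0 s).
(* Against [w] the density is [|U|^2]. *)
have UU s : inner (U s) (U s) = 0.
  rewrite -uE; apply: (integral_eq0_on_seg L0 uC) (valP s).
    move=> u uL; have /= -> := uE (exist _ u uL); apply: inner_ge0.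
    by have [] := Vsu (exist _ u uL).
  have /eqP := H _ _ wT; rewrite oppr_eq0 => /eqP; apply: etrans.
  apply/esym; apply: integral_segE => s'; rewrite uE vU wU.
  have [_ _ _ Lsu LL] := HorizD_Lam s' xH; have [_ Usu] := Vsu s'.
  rewrite inner_brk_brk// LL mul1r; have [_ ->] := VD s'.
  by rewrite expr0n subr0.
have U00 s : U s = 0 by apply: inner_su2_eq0 => //; have [] := Vsu s.
have [XJ Xx] := XE; have [KJ Kv] := KE.
(* [v X^*], whose derivative is [X U X^*]. *)
pose g := jmul K (jadj X).
have gJ : is_jet g by apply: is_jetM => //; exact: is_jet_adj.
have gD : forall s, g 0%N 1%N 0 (val s) = 0.
  move=> s; have [xU xD _ [La _] _] := HorizD_Lam s xH.
  have [xx x'x] := SU2_mulmx_adj xU.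
  have := jUE L0 (t := 0) s XE KE xH; rewrite vU U00.
  rewrite -[X in _ = X]/((X 0%N 0%N 0 (val s))^t* *m (K 0%N 1%N 0 (val s) -
    K 0%N 0%N 0 (val s) *m jLam X 0%N 0%N 0 (val s))).
  rewrite Xx Kv -(jLamE L0 (t := 0) s XE xH) => /(congr1 (mulmx (x s))).
  rewrite mulmx0 mulmxA xx mul1mx => E.
  rewrite -[LHS]/(K 0%N 1%N 0 (val s) *m (X 0%N 0%N 0 (val s))^t* +
    K 0%N 0%N 0 (val s) *m (X 0%N 1%N 0 (val s))^t*).
  rewrite -(family_jet_deriv L0 0 s XE) xD Xx Kv adjM La mulNmx mulmxN mulmxA.
  by rewrite -mulmxBl -E mul0mx.
have gs : forall s, g 0%N 0%N 0 (val s) = g 0%N 0%N 0 0.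
  apply: (mx_constant_on_seg (f' := g 0%N 1%N 0)) gD => u.
  by have [_ g's _] := gJ; exact: g's.
have g0 : g 0%N 0%N 0 0 = 0.
  have s00 : (0 : R) <= 0 <= L by apply/andP; split; [exact: lexx|exact: ltW].
  have := erefl (g 0%N 0%N 0 (val (exist _ 0 s00 : seg L))).
  rewrite -[RHS]/(K 0%N 0%N 0 (val (exist _ 0 s00 : seg L)) *m
     (X 0%N 0%N 0 (val (exist _ 0 s00 : seg L)))^t*) Kv vE V0// mulmx0 mul0mx.
  by [].
apply/funext => s; have [xU _ _ _ _] := HorizD_Lam s xH.
have [xx x'x] := SU2_mulmx_adj xU.
have : K 0%N 0%N 0 (val s) *m (X 0%N 0%N 0 (val s))^t* = 0 by rewrite -[RHS]g0 -(gs s).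
by rewrite Kv Xx => E; rewrite -[v s]mulmx1 -x'x mulmxA E mul0mx.
Qed.

End Nondegenerate.

Theorem theorem3 (R : realType) (L : R) (hL : 0 < L) :
  symplectic (@HorizD R L) (@tangentD R L) (@omega R L) /\
  symplectic (@HorizPD R L) (@tangentPD R L) (@omega R L).
Proof.
have MD : @HorizPD R L `<=` @HorizD R L by move=> x [F [xF _]]; exists F.
have TD x : @tangentPD R L x `<=` @tangentD R L x.
  by move=> v [V [U [vT _]]]; exists V, U.
split; split.
- exact: two_form_omega.
- move=> O xi1 xi2 xi3 [OM _]; exact: closed_omega.
- move=> x v xM [V [U vT]] H; apply: (nondegenerate_omega hL xM vT) => w W wT.
  by apply: H; exists W, (fun s => brk (Lam x s) (U s)).
- have [t1 t2 t3] := two_form_omega hL; split.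
  + move=> x v w xM vT wT; apply: t1; [exact: MD|exact: TD|exact: TD].
  + move=> x r u v w xM uT vT wT; apply: t2; [exact: MD|exact: TD|exact: TD|exact: TD].
  + move=> c v w [cS cM] vS vT wS wT; apply: t3 => // [|t|t].
    * by split=> // t; exact: MD.
    * exact: TD.
    * exact: TD.
- move=> O xi1 xi2 xi3 [OM _] [T1 S1] [T2 S2] [T3 S3].
  apply: closed_omega => //.
  + by move=> x /OM; exact: MD.
  + by split=> // x Ox; apply: TD; exact: T1.
  + by split=> // x Ox; apply: TD; exact: T2.
  + by split=> // x Ox; apply: TD; exact: T3.
- move=> x v xM [V [U [vT [u [uS uU uP]]]]] H.
  apply: (nondegenerate_omega hL (MD _ xM) vT) => w W wT.
  apply: H; exists W, (fun s => brk (Lam x s) (U s)); split=> //.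
  have [F [xF [g [gS gF gP]]]] := xM.
  have [G GJ GE] := mx_smooth1_jet gS; have [K KJ KE] := mx_smooth1_jet uS.
  (* The bracket formed from the periodic extensions of the frame and of [U]
     is a periodic extension. *)
  pose f := jbrk (jmul (jmul G (jcst (A1 R))) (jadj G)) K.
  have fE s : f 0%N 0%N 0 s = brk (g s *m A1 R *m (g s)^t*) (u s).
    by rewrite -(GE 0 s) -(KE 0 s).
  exists (f 0%N 0%N 0); split.
  + apply: mx_smooth1_slice_s; apply: is_jet_brk => //.
    by apply: is_jetM; [apply: is_jetM => //; exact: is_jet_cst|exact: is_jet_adj].
  + by move=> s; rewrite fE gF uU (Lam_frame s xF).
  + by move=> s; rewrite !fE gP uP.
Qed.
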